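(* Let $\Omega\subset\mathbb{R}^d$ be a bounded domain and let $0\le\rho<1$. Then the Riesz means $R_\rho(z)$ of the eigenvalues of the Dirichlet Laplacian on $\Omega$ satisfy, for all $z\ge 0$, $$R_{\rho}(z)\le K_{\rho,d}\,\Gamma(1+\rho)\,\Gamma(2-\rho)\,L_{1,d}^{cl}\,|\Omega|\,z^{\rho+\frac d2},$$ where $$K_{\rho,d}=\inf_{\theta>0}\frac{(1+\theta)^{1+d/2}}{\theta^{1-\rho}}=\frac{1}{(1-\rho)^{1-\rho}}\,\frac{(1+d/2)^{1+d/2}}{(\rho+d/2)^{\rho+d/2}}.$$
   Context: The eigenvalues of the Dirichlet Laplacian ($-\Delta u=\lambda u$ in $\Omega$, $u|_{\partial\Omega}=0$) on the bounded domain $\Omega\subset\mathbb{R}^d$ are counted with multiplicity and ordered increasingly, $\lambda_1<\lambda_2\le\lambda_3\le\cdots\to\infty$. For $\rho>0$ and $z\ge 0$ the Riesz mean is $R_\rho(z)=\sum_k (z-\lambda_k)_+^\rho$ with $(x)_+=\max(0,x)$; for $\rho=0$, $R_0(z)=N(z)$ is the counting function, the number of $k$ with $\lambda_k\le z$. $|\Omega|$ is the volume of $\Omega$, and the classical constant is $$L_{\rho,d}^{cl}=\frac{\Gamma(1+\rho)}{(4\pi)^{d/2}\,\Gamma(1+\rho+d/2)},$$ so that $L_{1,d}^{cl}=\frac{1}{(4\pi)^{d/2}\Gamma(2+d/2)}$. *)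

(* Defs.v *)
From HB Require Import structures.
From mathcomp Require Import all_boot all_order all_algebra.
From mathcomp Require Import all_classical all_reals all_analysis.

Set Implicit Arguments.
Unset Strict Implicit.
Unset Printing Implicit Defensive.

Import Order.TTheory GRing.Theory Num.Theory.
Import numFieldNormedType.Exports.

Local Open Scope classical_set_scope.
Local Open Scope ring_scope.

(** The sigma-algebra on row vectors is generated by the coordinates; as the
    topology of 'rV[R]_n is the (second countable) product topology, it is the
    Borel sigma-algebra of R^n. *)

Definition rV_display : measure_display -> measure_display.
Proof. exact. Qed.

Section measurable_rV.
Context (R : realType) (n : nat).

Let coords (i : 'I_n) (v : 'rV[R]_n) : R := v 0 i.

Let rV_set0 : g_sigma_preimage coords set0.
Proof. exact: sigma_algebra0. Qed.

Let rV_setC A : g_sigma_preimage coords A -> g_sigma_preimage coords (~` A).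
Proof. exact: sigma_algebraC. Qed.

Let rV_bigcup (F : (set 'rV[R]_n)^nat) :
  (forall i, g_sigma_preimage coords (F i)) ->
  g_sigma_preimage coords (\bigcup_i (F i)).
Proof. exact: sigma_algebra_bigcup. Qed.

HB.instance Definition _ :=
  @isMeasurable.Build (rV_display default_measure_display)
    'rV[R]_n (g_sigma_preimage coords) rV_set0 rV_setC rV_bigcup.

Lemma measurable_coord (i : 'I_n) :
  measurable_fun [set: 'rV[R]_n] (fun v : 'rV[R]_n => v 0 i).
Proof.
move=> _ Y mY; rewrite setTI; apply: sub_sigma_algebra => /=.
rewrite -bigcup_seq/=; exists i => /=; first by rewrite mem_index_enum.
by exists Y => //; rewrite setTI.
Qed.

Lemma measurable_fun_rV d (T : measurableType d) (f : T -> 'rV[R]_n) :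
  (forall i, measurable_fun [set: T] (fun t => f t 0 i)) ->
  measurable_fun [set: T] f.
Proof.
move=> mf; suff: g_sigma_preimage (fun i => coords i \o f) `<=` measurable.
  rewrite g_sigma_preimage_comp => sm _ A mA; apply: sm; exists A => //.
apply: smallest_sub; first exact: sigma_algebra_measurable.
rewrite -bigcup_seq => A [i _ [B mB <-]].
exact: mf.
Qed.

End measurable_rV.

Section lebesgue_measure_rV_step.
Context (R : realType) (n : nat).
Variable mu : {sigma_finite_measure set 'rV[R]_n -> \bar R}.

Definition cons_rV (p : measurableTypeR R * 'rV[R]_n) : 'rV[R]_n.+1 :=
  row_mx (const_mx p.1 : 'rV_1) p.2.

Let decons_rV (v : 'rV[R]_n.+1) : measurableTypeR R * 'rV[R]_n :=
  (v 0 0, @rsubmx R 1 1 n v).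

Lemma cons_rV0 p : cons_rV p 0 0 = p.1.
Proof.
rewrite /cons_rV (_ : 0 = lshift n (0 : 'I_1)); last exact: val_inj.
by rewrite (@row_mxEl _ 1 1 n) mxE.
Qed.

Lemma cons_rV_rshift p (i : 'I_n) : cons_rV p 0 (rshift 1 i) = p.2 0 i.
Proof. by rewrite /cons_rV (@row_mxEr _ 1 1 n). Qed.

Let cons_rVK : cancel cons_rV decons_rV.
Proof.
by case=> x v; rewrite /decons_rV cons_rV0 /cons_rV row_mxKr.
Qed.

Let measurable_decons_rV : measurable_fun setT decons_rV.
Proof.
apply/measurable_fun_pair; first exact: measurable_coord.
apply: measurable_fun_rV => i.
rewrite (_ : (fun _ => _) = (fun v : 'rV[R]_n.+1 => v 0 (@rshift 1 n i))).
  exact: measurable_coord.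
by apply/funext => v; rewrite mxE.
Qed.

Lemma measurable_cons_rV : measurable_fun setT cons_rV.
Proof.
apply: measurable_fun_rV => i; have [j|j] := @split_ordP 1 n i => ->.
  rewrite (_ : lshift n j = 0); last by apply: val_inj; rewrite ord1.
  by under eq_fun do rewrite cons_rV0; exact: measurable_fst.
under eq_fun do rewrite cons_rV_rshift.
exact: (measurableT_comp (measurable_coord j)).
Qed.

Definition lebesgue_rV_step : set 'rV[R]_n.+1 -> \bar R :=
  pushforward (@lebesgue_measure R \x mu)%E cons_rV.

HB.instance Definition _ := Measure.copy lebesgue_rV_step
  (measure_function_pushforward__canonical__measure_function_Measure
     (@lebesgue_measure R \x mu)%E measurable_cons_rV).

Let sigma_finite_step : sigma_finite setT lebesgue_rV_step.
Proof.
have /sigma_finiteP[F [FT ndF Foo]] := sigma_finiteT (@lebesgue_measure R).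
have /sigma_finiteP[G [GT ndG Goo]] := sigma_finiteT mu.
exists (fun k => decons_rV @^-1` (F k `*` G k)).
  apply/esym; rewrite -subTset => v _.
  have [i _ Fi] : (\bigcup_i F i) (v 0 0) by rewrite -FT.
  have [j _ Gj] : (\bigcup_j G j) (@rsubmx R 1 1 n v) by rewrite -GT.
  exists (maxn i j) => //; split => /=.
    by move: Fi; exact/subsetPset/ndF/leq_maxl.
  by move: Gj; exact/subsetPset/ndG/leq_maxr.
move=> k; have [mF Fk] := Foo k; have [mG Gk] := Goo k.
have mFG : measurable (F k `*` G k) by exact: measurableX.
split; first by rewrite -[X in measurable X]setTI; exact: measurable_decons_rV.
rewrite /lebesgue_rV_step /pushforward -comp_preimage.
rewrite (_ : decons_rV \o cons_rV = id); last exact/funext/cons_rVK.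
by rewrite preimage_id product_measure1E// lte_mul_pinfty// ge0_fin_numE.
Qed.

HB.instance Definition _ :=
  Measure_isSigmaFinite.Build _ _ _ lebesgue_rV_step sigma_finite_step.

End lebesgue_measure_rV_step.

Fixpoint lebesgue_rV (R : realType) (n : nat) :
    {sigma_finite_measure set 'rV[R]_n -> \bar R} :=
  match n with
  | 0 => \d_(0 : 'rV[R]_0)
  | m.+1 => lebesgue_rV_step (lebesgue_rV R m)
  end.

Arguments lebesgue_rV {R n}.

(* Normalization check: the measure of a box is the product of its sides. *)
Lemma lebesgue_rV_box (R : realType) (n : nat) (a b : 'rV[R]_n) :
  (forall i, a 0 i <= b 0 i) ->
  lebesgue_rV [set v : 'rV[R]_n | forall i, v 0 i \in `[a 0 i, b 0 i]] =
  (\prod_i (b 0 i - a 0 i))%:E.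
Proof.
elim: n a b => [|n IHn] a b ab.
  by rewrite big_ord0 /= diracE mem_set//= => -[].
pose a' : 'rV[R]_n := @rsubmx R 1 1 n a.
pose b' : 'rV[R]_n := @rsubmx R 1 1 n b.
have a'E i : a' 0 i = a 0 (@rshift 1 n i) by rewrite mxE.
have b'E i : b' 0 i = b 0 (@rshift 1 n i) by rewrite mxE.
pose box m (u v : 'rV[R]_m) :=
  [set w : 'rV[R]_m | forall i, w 0 i \in `[u 0 i, v 0 i]].
have mbox m (u v : 'rV[R]_m) : measurable (box m u v).
  rewrite (_ : box m u v =
      \bigcap_(i in [set: 'I_m]) ((fun w => w 0 i) @^-1` `[u 0 i, v 0 i])).
    apply: fin_bigcap_measurable => // i _.
    rewrite -[X in measurable X]setTI; exact: measurable_coord.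
  by apply/seteqP; split => w /= H i; [move=> _; exact: H|exact: H].
rewrite /= /lebesgue_rV_step /pushforward.
rewrite (_ : @cons_rV R n @^-1` _ = `[a 0 0, b 0 0] `*` box n a' b'); last first.
  apply/seteqP; split => -[x v] /=.
    move=> H; split => [|i]; first by have := H 0; rewrite cons_rV0.
    by have := H (@rshift 1 n i); rewrite cons_rV_rshift a'E b'E.
  move=> [Hx Hv] i; have [j|j] := @split_ordP 1 n i => ->.
    by rewrite (_ : lshift n j = 0) ?cons_rV0//; apply: val_inj; rewrite ord1.
  by have := Hv j; rewrite cons_rV_rshift a'E b'E.
have -> : \prod_i (b 0 i - a 0 i) = (b 0 0 - a 0 0) * \prod_i (b' 0 i - a' 0 i).
  rewrite big_ord_recl; congr (_ * _); apply: eq_bigr => i _; rewrite a'E b'E.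
  by rewrite (_ : rshift 1 i = lift ord0 i)//; exact: val_inj.
rewrite EFinM -IHn => [|i]; last by rewrite a'E b'E.
have <- : lebesgue_measure (`[a 0 0, b 0 0]%classic : set R) =
    (b 0 0 - a 0 0)%:E.
  rewrite lebesgue_measure_itv/= lte_fin EFinB.
  have := ab 0; rewrite le_eqVlt => /predU1P[->|->//].
  by rewrite ltxx subee.
by apply: product_measure1E => //; exact: mbox.
Qed.

Definition partial (R : realType) (d : nat) (i : 'I_d) (f : 'rV[R]_d -> R) :
  'rV[R]_d -> R := 'D_(delta_mx 0 i) f.

Definition iter_partial (R : realType) (d : nat) (s : seq 'I_d)
  (f : 'rV[R]_d -> R) : 'rV[R]_d -> R := foldr (@partial R d) f s.

Definition smooth (R : realType) (d : nat) (f : 'rV[R]_d -> R) : Prop :=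
  forall s : seq 'I_d,
    continuous (iter_partial s f) /\
    forall (i : 'I_d) (x : 'rV[R]_d),
      derivable (iter_partial s f) x (delta_mx 0 i).

Definition test_function (R : realType) (d : nat) (Omega : set 'rV[R]_d)
    (f : 'rV[R]_d -> R) : Prop :=
  [/\ smooth f, compact (closure [set x | f x != 0]) &
      closure [set x | f x != 0] `<=` Omega].

(* L^2 convergence; square integrability of [g] follows from that of the [f k]. *)
Definition cvg_L2 (R : realType) (d : nat) (Omega : set 'rV[R]_d)
    (f : nat -> 'rV[R]_d -> R) (g : 'rV[R]_d -> R) : Prop :=
  measurable_fun Omega g /\
  (\int[lebesgue_rV]_(x in Omega) ((f k x - g x) ^+ 2)%:E)%E
    @[k --> \oo] --> 0%E.

(* [u] belongs to H^1_0(Omega), the closure of the test functions in H^1, and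
   [Du] is its weak gradient. *)
Definition H10 (R : realType) (d : nat) (Omega : set 'rV[R]_d)
    (u : 'rV[R]_d -> R) (Du : 'I_d -> 'rV[R]_d -> R) : Prop :=
  exists phi : nat -> 'rV[R]_d -> R,
    [/\ forall k, test_function Omega (phi k),
        cvg_L2 Omega phi u &
        forall i, cvg_L2 Omega (fun k => partial i (phi k)) (Du i)].

(** Weak solutions of the Dirichlet problem -Delta u = t u in Omega, u = 0 on
    the boundary (zero included) *)
Definition dirichlet_eigenspace (R : realType) (d : nat)
    (Omega : set 'rV[R]_d) (t : R) : set ('rV[R]_d -> R) :=
  [set u | exists Du, H10 Omega u Du /\
    forall psi, test_function Omega psi ->
      \int[lebesgue_rV]_(x in Omega) (\sum_i Du i x * partial i psi x) =
      t * \int[lebesgue_rV]_(x in Omega) (u x * psi x)].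

(* [t] has multiplicity [m]: the eigenspace, taken modulo equality almost
   everywhere on Omega, has dimension [m] (with [m = 0] when [t] is not an
   eigenvalue). *)
Definition dirichlet_multiplicity (R : realType) (d : nat)
    (Omega : set 'rV[R]_d) (t : R) (m : nat) : Prop :=
  exists e : 'I_m -> 'rV[R]_d -> R,
    [/\ forall j, dirichlet_eigenspace Omega t (e j),
        forall c : 'I_m -> R,
          ae_eq lebesgue_rV Omega (fun x => \sum_j c j * e j x) (cst 0) ->
          forall j, c j = 0 &
        forall u, dirichlet_eigenspace Omega t u ->
          exists c : 'I_m -> R,
            ae_eq lebesgue_rV Omega u (fun x => \sum_j c j * e j x)].

(* [lambda] lists the Dirichlet eigenvalues in nondecreasing order, each one
   repeated according to its multiplicity (indices start at 0). *)
Definition dirichlet_eigenvalues (R : realType) (d : nat)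
    (Omega : set 'rV[R]_d) (lambda : nat -> R) : Prop :=
  nondecreasing_seq lambda /\
  forall t : R, exists m : nat,
    dirichlet_multiplicity Omega t m /\ ([set k | lambda k = t] #= `I_m)%card.

Definition riesz_mean (R : realType) (lambda : nat -> R) (rho z : R) :
    \bar R :=
  if rho == 0 then counting [set k | lambda k <= z]
  else (\sum_(0 <= k <oo) ((Num.max 0 (z - lambda k)) `^ rho)%:E)%E.

Definition Gamma (R : realType) (x : R) : R :=
  \int[lebesgue_measure]_(t in `]0, +oo[) (t `^ (x - 1) * expR (- t)).

Definition Lcl (R : realType) (rho : R) (d : nat) : R :=
  Gamma (1 + rho) /
  ((4 * pi) `^ (d%:R / 2) * Gamma (1 + rho + d%:R / 2)).

Definition Kconst (R : realType) (rho : R) (d : nat) : R :=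
  inf [set (1 + theta) `^ (1 + d%:R / 2) / theta `^ (1 - rho)
      | theta in [set theta : R | 0 < theta]].

(* Main.v *)
Require Import Defs.
From HB Require Import structures.
From mathcomp Require Import all_boot all_order all_algebra.
From mathcomp Require Import all_classical all_reals all_analysis.
From mathcomp Require Import measurable_realfun ring lra.

Set Implicit Arguments.
Unset Strict Implicit.
Unset Printing Implicit Defensive.

Import Order.TTheory GRing.Theory Num.Theory.
Import numFieldNormedType.Exports.

Local Open Scope classical_set_scope.
Local Open Scope ring_scope.

(** Why the bound holds.

    The case rho = 1 is the Berezin-Li-Yau inequality
      sum_k (z - lambda_k)_+ <= Lcl 1 d * |Omega| * z^(1 + d/2),
    and the case rho < 1 follows from it term by term: by the weighted
    arithmetic-geometric mean inequality (scaled_amgm), for a > 0,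
      x_+^rho <= rho^rho (1 - rho)^(1 - rho) a^(rho - 1) (x + a)_+.
    With x = z - lambda_k and a = theta * z this bounds the Riesz mean of order
    rho at z by the one of order 1 at (1 + theta) z, up to the factor
    (1 + theta)^(1 + d/2) / theta^(1 - rho), whose minimum over theta is
    Kconst.  What is left is that the constant rho^rho (1 - rho)^(1 - rho) is at
    most Gamma (1 + rho) * Gamma (2 - rho) (Gamma_mul_ge), which comes from
    Gamma (1 + r) >= (1 + r)^(r - 1) at r = rho and r = 1 - rho.

    The Berezin-Li-Yau inequality is usually proved by the Plancherel theorem:
    if the u_j are orthonormal eigenfunctions, extended by 0, then
      sum_j (z - lambda_j) = (2 pi)^(-d) int (z - |xi|^2) sum_j |u_j^(xi)|^2 dxi
    and Bessel's inequality for the plane wave on Omega bounds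
    sum_j |u_j^(xi)|^2 by |Omega|.  Here the Fourier transform is taken on a
    finite lattice, where Plancherel's formula is the orthogonality of the
    characters of a finite group.  Test functions are sampled on a grid of mesh
    h = L / N in a box of side L, which is treated as the torus (Z/N)^d.  The
    discrete inequality (discrete_berezin) bounds the sampled quantity by
    h^d * #(grid points in the supports) * L^(-d) * sum_k (z - symbol_k)_+,
    with symbol_k the eigenvalue of the discrete Laplacian.  As h tends to 0,
    Riemann sums converge (near_gram, near_energy), the cells of the grid points
    in the supports lie in Omega (support_count), and the frequency sum is
    compared with the integral of (z - |xi|^2)_+ (freq_sum_le).  Then L tends to
    infinity, which gives test_function_berezin.

    The integral of (z - |v|^2)_+ over R^d is V * z^(1 + d/2) by scaling.
    Multiplying by exp(-z), integrating over z and exchanging the integrals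
    turns it into a Gaussian integral, so V * Gamma (2 + d/2) = pi^(d/2)
    (riesz_volume_Gamma); this is the origin of Lcl 1 d.

    Finally eigenfunctions are limits of test functions.  Eigenspaces of
    distinct eigenvalues are orthogonal by the weak equation
    (eigenpair_orthogonal), and an orthonormal family adapted to the list of
    eigenvalues is built one index at a time by counting dimensions
    (orthonormal_eigenfamily); the bound for test functions then passes to the
    limit (eigen_berezin). *)

(** * Fourier analysis on a discrete torus *)

Section torus_fourier.
Context {R : realType} {d N' : nat} (M : nat).
Let N := N'.+1.
Local Notation torus := {ffun 'I_d -> 'I_N}.

(** The entry is [inZp 1] rather than [1] because ['I_N'.+1] is only an additive
    group: for N' = 0 it has no ring structure. *)
Definition torus_shift (i : 'I_d) : torus :=
  [ffun j => if j == i then inZp 1 else 0].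

(** Frequencies are centred at 0 by the offset M, so that for N = 2M + 1 they lie
    in [-pi, pi], where the symbol of the discrete Laplacian is comparable with
    the square of the frequency. *)
Definition freq (k : torus) (i : 'I_d) : R :=
  2 * pi * ((k i)%:R - M%:R) / N%:R.

Definition phase (k n : torus) : R := \sum_i freq k i * (n i)%:R.

Definition fcos (g : torus -> R) (k : torus) := \sum_n g n * cos (phase k n).
Definition fsin (g : torus -> R) (k : torus) := \sum_n g n * sin (phase k n).

(** The squared modulus of the Fourier coefficient of a real function. *)
Definition power (g : torus -> R) k := fcos g k ^+ 2 + fsin g k ^+ 2.

Let N_neq0 : N%:R != 0 :> R.
Proof. by rewrite pnatr_eq0. Qed.

Lemma cos_sinD2pin (x : R) (n : nat) :
  cos (x + 2 * pi * n%:R) = cos x /\ sin (x + 2 * pi * n%:R) = sin x.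
Proof.
elim: n => [|n [IHc IHs]]; first by rewrite mulr0 addr0.
have -> : x + 2 * pi * n.+1%:R = (x + 2 * pi * n%:R) + pi *+ 2.
  by rewrite -natr1 -mulr_natr; ring.
by rewrite cosD2pi sinD2pi.
Qed.

(** Phases are only well defined modulo 2 pi, because shifts on the torus wrap
    around; the multiple of 2 pi is kept as a difference of natural numbers. *)
Lemma cos_sinD2piz (x y : R) (a b : nat) :
  y = x + 2 * pi * (a%:R - b%:R) -> cos y = cos x /\ sin y = sin x.
Proof.
move=> yE.
have [ca sa] := cos_sinD2pin x a; have [cb sb] := cos_sinD2pin y b.
have E : y + 2 * pi * b%:R = x + 2 * pi * a%:R by rewrite yE; ring.
by rewrite -cb -sb E.
Qed.

Lemma cos_neq1 (x : R) : 0 < x < 2 * pi -> cos x != 1.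
Proof.
move=> /andP[x0 x2].
have : 0 < sin (x / 2).
  by apply: sin_gt0_pi; rewrite divr_gt0//= ltr_pdivrMr// mulrC.
rewrite {2}(_ : x = (x / 2) *+ 2); last by rewrite -mulr_natr divfK.
rewrite cos_mulr2n => s0; apply/eqP => E.
have := sin2cos2 (x / 2); have : 0 < sin (x/2) ^+ 2 by rewrite exprn_gt0.
by rewrite -mulr_natr in E; lra.
Qed.

Let val_shift (n : torus) i :
  exists w : bool, ((n + torus_shift i)%R i)%:R = (n i)%:R + 1 - w%:R * N%:R :> R.
Proof.
rewrite !ffunE eqxx /=; set a := n i.
rewrite modnDmr addn1; have := ltn_ord a; rewrite leq_eqVlt => /predU1P[E|lt].
  by exists true; rewrite E modnn /= mul1r -{2}E -natr1 subrr.
by exists false; rewrite modn_small// mul0r subr0 -natr1.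
Qed.

Let shift_neq (n : torus) i j : j != i -> (n + torus_shift i) j = n j.
Proof. by move=> ji; rewrite !ffunE (negbTE ji) addr0. Qed.

Lemma freqS k i : exists w : bool,
  freq (k + torus_shift i) i = freq k i + 2 * pi / N%:R - 2 * pi * w%:R.
Proof.
by have [w E] := val_shift k i; exists w; rewrite /freq E; field.
Qed.

Lemma phase_shift k n i : exists a b : nat,
  phase k (n + torus_shift i) = phase k n + freq k i + 2 * pi * (a%:R - b%:R).
Proof.
have [w E] := val_shift n i.
exists (w * M)%N, (w * k i)%N; rewrite /phase (bigD1 i)//= [in RHS](bigD1 i)//= E.
under eq_bigr => j ji do rewrite shift_neq//.
rewrite /freq !natrM; move: N%:R N_neq0 => n0 n0_neq0; move: (\sum_(j | _) _) => S.
by field.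
Qed.

Lemma phase_freq_shift k n i : exists a b : nat,
  phase (k + torus_shift i) n =
  phase k n + 2 * pi / N%:R * (n i)%:R + 2 * pi * (a%:R - b%:R).
Proof.
have [w E] := freqS k i.
exists 0%N, (w * n i)%N; rewrite /phase (bigD1 i)//= [in RHS](bigD1 i)//= E.
under eq_bigr => j ji do rewrite /freq shift_neq//.
by rewrite natrM; ring.
Qed.

(** Orthogonality of characters.  If n and m differ in coordinate i, shifting k
    in that direction rotates the pair (sum of cosines, sum of sines) by the
    angle t, which is not a multiple of 2 pi, yet leaves the sums unchanged; a
    vector fixed by a nontrivial rotation is 0. *)
Lemma sum_cos_phaseB n m :
  \sum_k cos (phase k n - phase k m) = (N ^ d)%:R * (n == m)%:R.
Proof.
have [->|nm] := eqVneq n m.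
  under eq_bigr do rewrite subrr cos0.
  by rewrite sumr_const mulr1 card_ffun !card_ord.
rewrite mulr0.
have [i ni] : exists i, n i != m i.
  by apply/existsP; move: nm; apply: contraR; rewrite negb_exists => /forallP H;
     apply/eqP/ffunP => i; have := H i; rewrite negbK => /eqP.
pose t : R := 2 * pi / N%:R * ((n i)%:R - (m i)%:R).
set C := \sum_k _; pose S := \sum_k sin (phase k n - phase k m).
have shf k : cos (phase (k + torus_shift i) n - phase (k + torus_shift i) m) =
    cos (phase k n - phase k m + t) /\
    sin (phase (k + torus_shift i) n - phase (k + torus_shift i) m) =
    sin (phase k n - phase k m + t).
  have [a [b E]] := phase_freq_shift k n i.
  have [a' [b' E']] := phase_freq_shift k m i.
  apply: (@cos_sinD2piz _ _ (a + b')%N (b + a')%N).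
  by rewrite E E' /t !natrD; ring.
have CE : C = C * cos t - S * sin t.
  rewrite {1}/C (reindex_inj (addIr (torus_shift i))) /=.
  under eq_bigr => k _ do rewrite (shf k).1 cosD.
  by rewrite sumrB -!mulr_suml.
have SE : S = S * cos t + C * sin t.
  rewrite {1}/S (reindex_inj (addIr (torus_shift i))) /=.
  under eq_bigr => k _ do rewrite (shf k).2 sinD.
  by rewrite big_split/= -!mulr_suml.
have ct : cos t != 1.
  rewrite -cos_norm; apply: cos_neq1.
  have pN : 0 < 2 * pi / N%:R :> R by rewrite divr_gt0 ?mulr_gt0 ?pi_gt0.
  rewrite /t normrM (gtr0_norm pN) mulr_gt0 ?normr_gt0 ?subr_eq0 ?eqr_nat//=.
  rewrite -[ltRHS](divfK N_neq0) ltr_pM2l// ltr_norml.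
  have a0 : 0 <= (n i)%:R :> R by rewrite ler0n.
  have b0 : 0 <= (m i)%:R :> R by rewrite ler0n.
  have aN : (n i)%:R < N%:R :> R by rewrite ltr_nat.
  have bN : (m i)%:R < N%:R :> R by rewrite ltr_nat.
  by lra.
(* The matrix (rotation by t) - identity has determinant 2 (1 - cos t). *)
have : C * (2 * (1 - cos t)) = 0.
  have cs := cos2Dsin2 t.
  have H1 : C * (1 - cos t) = - (S * sin t) by lra.
  have H2 : S * (1 - cos t) = C * sin t by lra.
  nra.
move/eqP; rewrite mulf_eq0 => /orP[/eqP//|].
by rewrite mulf_eq0 pnatr_eq0/= subr_eq0 eq_sym (negbTE ct).
Qed.

Lemma powerE g k :
  power g k = \sum_n \sum_m g n * g m * cos (phase k n - phase k m).
Proof.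
rewrite /power !expr2 /fcos /fsin !mulr_suml -big_split/=; apply: eq_bigr => n _.
rewrite !mulr_sumr -big_split/=; apply: eq_bigr => m _.
by rewrite cosB; ring.
Qed.

(** Plancherel's formula: in the expanded squares only the terms n = m survive the
sum over k. *)
Lemma sum_power g : \sum_k power g k = (N ^ d)%:R * \sum_n g n ^+ 2.
Proof.
under eq_bigr do rewrite powerE.
rewrite exchange_big mulr_sumr; apply: eq_bigr => n _/=.
rewrite exchange_big/= (bigD1 n)//= -mulr_sumr sum_cos_phaseB eqxx big1; last first.
  by move=> m mn; rewrite -mulr_sumr sum_cos_phaseB eq_sym (negbTE mn) !mulr0.
by rewrite addr0 mulr1 mulrC -expr2.
Qed.

(** A difference operator multiplies the Fourier transform by a phase minus 1,
    whose squared modulus is 2 (1 - cos). *)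
Lemma power_diff g k i :
  power (fun n => g (n + torus_shift i) - g n) k =
  2 * (1 - cos (freq k i)) * power g k.
Proof.
have shf n : cos (phase k n) = cos (phase k (n + torus_shift i) - freq k i) /\
             sin (phase k n) = sin (phase k (n + torus_shift i) - freq k i).
  have [a [b E]] := phase_shift k n i.
  by apply: (@cos_sinD2piz _ _ b a); rewrite E; ring.
have cE : fcos (fun n => g (n + torus_shift i) - g n) k =
    fcos g k * (cos (freq k i) - 1) + fsin g k * sin (freq k i).
  rewrite /fcos /fsin; under eq_bigr do rewrite mulrBl.
  rewrite sumrB [X in X - _](_ : _ =
      \sum_n g n * cos (phase k n - freq k i)); last first.
    rewrite [RHS](reindex_inj (addIr (torus_shift i))) /=.
    by apply: eq_bigr => n _; rewrite (shf n).1.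
  rewrite -sumrB !mulr_suml -big_split/=; apply: eq_bigr => n _.
  by rewrite cosB; ring.
have sE : fsin (fun n => g (n + torus_shift i) - g n) k =
    fsin g k * (cos (freq k i) - 1) - fcos g k * sin (freq k i).
  rewrite /fcos /fsin; under eq_bigr do rewrite mulrBl.
  rewrite sumrB [X in X - _](_ : _ =
      \sum_n g n * sin (phase k n - freq k i)); last first.
    rewrite [RHS](reindex_inj (addIr (torus_shift i))) /=.
    by apply: eq_bigr => n _; rewrite (shf n).2.
  rewrite -sumrB !mulr_suml -sumrB; apply: eq_bigr => n _.
  by rewrite sinB; ring.
have := sin2cos2 (freq k i).
rewrite /power cE sE; set c := cos _; set s := sin _ => s2.
transitivity ((fcos g k ^+ 2 + fsin g k ^+ 2) * ((1 - c) ^+ 2 + s ^+ 2)).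
  by ring.
by rewrite s2; ring.
Qed.

(** Bessel's inequality for a family that is only almost orthonormal: the Gram
    matrix is at most B as a quadratic form.  Since the [g j] vanish off A, only
    the restriction of f to A matters. *)
Lemma bessel_le (J : finType) (g : J -> torus -> R) (A : {set torus}) (B : R)
    (f : torus -> R) : 0 < B ->
  (forall j n, n \notin A -> g j n = 0) ->
  (forall c : J -> R, \sum_n (\sum_j c j * g j n) ^+ 2 <= B * \sum_j c j ^+ 2) ->
  \sum_j (\sum_n g j n * f n) ^+ 2 <= B * \sum_(n in A) f n ^+ 2.
Proof.
move=> B0 gA gB; pose c j := \sum_n g j n * f n.
pose w n := \sum_j c j * g j n.
have wA n : n \notin A -> w n = 0.
  by move=> nA; rewrite /w big1// => j _; rewrite gA// mulr0.
have SE : \sum_j c j ^+ 2 = \sum_(n in A) f n * w n.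
  rewrite (_ : \sum_(n in A) _ = \sum_n f n * w n); last first.
    rewrite [RHS](bigID (mem A))/= [X in _ = _ + X]big1 ?addr0// => n nA.
    by rewrite wA// mulr0.
  under [RHS]eq_bigr do rewrite mulr_sumr.
  rewrite exchange_big/=; apply: eq_bigr => j _.
  rewrite expr2 {2}/c mulr_sumr; apply: eq_bigr => n _; ring.
(* 2 f w <= B f^2 + w^2 / B, the weights being matched to the bound on w. *)
have le2 : 2 * \sum_(n in A) f n * w n <=
    B * \sum_(n in A) f n ^+ 2 + B^-1 * \sum_n w n ^+ 2.
  rewrite (_ : \sum_n w n ^+ 2 = \sum_(n in A) w n ^+ 2); last first.
    rewrite [LHS](bigID (mem A))/= [X in _ + X]big1 ?addr0// => n nA.
    by rewrite wA// expr0n.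
  rewrite !mulr_sumr -big_split/=; apply: ler_sum => n _.
  rewrite -subr_ge0 [leRHS](_ : _ = B^-1 * (B * f n - w n) ^+ 2); last first.
    by field; rewrite gt_eqF.
  by rewrite mulr_ge0 ?sqr_ge0// invr_ge0 ltW.
have : B^-1 * \sum_n w n ^+ 2 <= \sum_j c j ^+ 2.
  by rewrite ler_pdivrMl//; exact: gB.
move=> leS; change (\sum_j c j ^+ 2 <= B * \sum_(n in A) f n ^+ 2).
by lra.
Qed.

(** The Berezin-Li-Yau argument on the torus.  Plancherel writes the left-hand
    side as the mean over k of (z - symbol k) times the total power at frequency
    k; the negative part of the first factor is discarded and the second one is
    at most B * #|A|, by Bessel's inequality and cos^2 + sin^2 = 1. *)
Lemma discrete_berezin (J : finType) (g : J -> torus -> R) (A : {set torus})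
    (B z h : R) : 0 < B -> 0 < h ->
  (forall j n, n \notin A -> g j n = 0) ->
  (forall c : J -> R, \sum_n (\sum_j c j * g j n) ^+ 2 <= B * \sum_j c j ^+ 2) ->
  \sum_j (z * (\sum_n g j n ^+ 2) -
     \sum_i \sum_(n : torus) ((g j (n + torus_shift i) - g j n) / h) ^+ 2) <=
  B * #|A|%:R * ((N ^ d)%:R^-1 *
     \sum_k Num.max 0 (z - \sum_i 2 * (1 - cos (freq k i)) / h ^+ 2)).
Proof.
move=> B0 h0 gA gB; pose s k := \sum_i 2 * (1 - cos (freq k i)) / h ^+ 2.
have N0 : (N ^ d)%:R != 0 :> R by rewrite pnatr_eq0 expn_eq0.
have Np : 0 < (N ^ d)%:R :> R by rewrite lt0r N0/=.
have PB k : \sum_j power (g j) k <= B * #|A|%:R.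
  rewrite big_split/= (_ : B * _ = B * (\sum_(n in A) cos (phase k n) ^+ 2) +
                                  B * (\sum_(n in A) sin (phase k n) ^+ 2)).
    by apply: lerD; exact: bessel_le.
  rewrite -mulrDr -big_split/=; under eq_bigr do rewrite cos2Dsin2.
  by rewrite sumr_const.
have jE j : z * (\sum_n g j n ^+ 2) -
     \sum_i \sum_(n : torus) ((g j (n + torus_shift i) - g j n) / h) ^+ 2 =
    (N ^ d)%:R^-1 * \sum_k (z - s k) * power (g j) k.
  have E i : \sum_(n : torus) ((g j (n + torus_shift i) - g j n) / h) ^+ 2 =
      (N ^ d)%:R^-1 * \sum_k 2 * (1 - cos (freq k i)) / h ^+ 2 * power (g j) k.
    under eq_bigr do rewrite expr_div_n.
    rewrite -mulr_suml -[X in X / _](mulKf N0) -sum_power.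
    under eq_bigr do rewrite power_diff.
    rewrite -mulrA mulr_suml; congr (_ * _); apply: eq_bigr => k _.
    by rewrite mulrAC.
  rewrite -[X in z * X](mulKf N0) -sum_power.
  under [X in _ - X]eq_bigr do rewrite E.
  rewrite -mulr_sumr mulrCA -mulrBr; congr (_ * _).
  rewrite mulr_sumr exchange_big -sumrB/=; apply: eq_bigr => k _.
  by rewrite mulrBl mulr_suml.
under eq_bigr do rewrite jE.
rewrite -mulr_sumr exchange_big mulrCA ler_pM2l ?invr_gt0// mulr_sumr.
apply: ler_sum => k _; rewrite -mulr_sumr.
have [zs|zs] := leP (z - s k) 0.
  rewrite mulr0; apply: mulr_le0_ge0 => //; apply: sumr_ge0 => j _.
  by rewrite addr_ge0// sqr_ge0.
by rewrite [leRHS]mulrC ler_pM2l.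
Qed.
End torus_fourier.

(** * Lebesgue measure on row vectors: Borel sets, iterated integrals, scaling *)

Section measure_rV.
Context {R : realType}.
Local Notation mu := (@lebesgue_measure R).

Lemma measurable_coord_itv n (i : 'I_n) (I : interval R) :
  measurable [set v : 'rV[R]_n | v 0 i \in I].
Proof.
rewrite (_ : mkset _ = setT `&` (fun v : 'rV[R]_n => v 0 i) @^-1` [set` I]).
  exact: measurable_coord.
by rewrite setTI.
Qed.

Lemma measurable_coords_itv n (I : 'I_n -> interval R) :
  measurable [set v : 'rV[R]_n | forall i, v 0 i \in I i].
Proof.
rewrite (_ : mkset _ =
    \bigcap_(i in [set: 'I_n]) [set v : 'rV[R]_n | v 0 i \in I i]).
  by apply: fin_bigcap_measurable => // i _; exact: measurable_coord_itv.
by apply/seteqP; split => v /= H i; [move=> _; exact: H|exact: H].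
Qed.

(** Every open set is a countable union of boxes with rational corners, and the
    boxes are generated by the coordinates. *)
Lemma open_measurable_rV n (U : set 'rV[R]_n) : open U -> measurable U.
Proof.
move=> oU.
pose box (q : 'rV[rat]_n * 'rV[rat]_n) :=
  [set v : 'rV[R]_n | forall i, v 0 i \in `]ratr (q.1 0 i), ratr (q.2 0 i)[].
pose F q := if `[< box q `<=` U >] then box q else set0.
suff -> : U = \bigcup_q F q.
  apply: countable_bigcupT_measurable => // q.
  by rewrite /F; case: ifP => // _; exact: measurable_coords_itv.
apply/seteqP; split => [x Ux|x [q _]]; last first.
  by rewrite /F; case: asboolP => // sub /sub.
have /nbhs_ballP[e /= e0 xeU] : nbhs x U by exact: open_nbhs_nbhs.
have lo i : exists q : rat, ratr q \in `]x 0 i - e, x 0 i[.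
  have [|q ?] := @rat_in_itvoo R (x 0 i - e) (x 0 i); last by exists q.
  by rewrite ltrBlDr ltrDl.
have hi i : exists q : rat, ratr q \in `]x 0 i, x 0 i + e[.
  have [|q ?] := @rat_in_itvoo R (x 0 i) (x 0 i + e); last by exists q.
  by rewrite ltrDl.
have /choice[a aP] := lo; have /choice[b bP] := hi.
exists (\row_i a i, \row_i b i) => //.
have sub : box (\row_i a i, \row_i b i) `<=` U.
  move=> v vb; apply: xeU; split=> // i j; rewrite (ord1 i) /ball/= ltr_distlC.
  have := vb j; have := aP j; have := bP j; rewrite !in_itv/= !mxE.
  by move=> /andP[_ b2] /andP[a1 _] /andP[v1 v2]; apply/andP; split; lra.
rewrite /F asboolT// => i; rewrite !mxE in_itv/=.
by have := aP i; have := bP i; rewrite !in_itv/= => /andP[-> _] /andP[_ ->].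
Qed.

Lemma continuous_measurable_rV n (f : 'rV[R]_n -> R) :
  continuous f -> measurable_fun setT f.
Proof.
move=> /continuousP cf; apply: (measurability _ (RGenOpens.measurableE R)).
move=> _ [_ [a [b ->] <-]]; rewrite setTI.
by apply: open_measurable_rV; apply: cf; exact: interval_open.
Qed.

Lemma ge0_integral_rVS n (f : 'rV[R]_n.+1 -> \bar R) :
  measurable_fun setT f -> (forall v, 0 <= f v)%E ->
  (\int[lebesgue_rV]_v f v =
   \int[mu]_x \int[lebesgue_rV]_v f (cons_rV (x, v)))%E.
Proof.
move=> mf f0.
rewrite [LHS](_ : _ = \int[mu \x lebesgue_rV]_p (f \o @cons_rV R n) p)%E.
  rewrite fubini_tonelli1//; last by move=> p; exact: f0.
  by apply: measurableT_comp => //; exact: measurable_cons_rV.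
rewrite /= /lebesgue_rV_step ge0_integral_pushforward//.
  exact: measurable_cons_rV.
Qed.

(** The measure c * (image of Lebesgue measure under x |-> c x) gives each
    interval its length, so it is Lebesgue measure. *)
Lemma ge0_integral_scale1 (c : R) (f : R -> \bar R) : 0 < c ->
  measurable_fun setT f -> (forall x, 0 <= f x)%E ->
  (\int[mu]_x f (c * x)%R = c^-1%:E * \int[mu]_x f x)%E.
Proof.
move=> c0 mf f0.
pose s : measurableTypeR R -> measurableTypeR R := *%R c.
have ms : measurable_fun setT s by exact: mulrl_measurable.
have cge0 : 0 <= c by exact: ltW.
have E (A : set (measurableTypeR R)) : measurable A ->
    mu A = mscale (NngNum cge0) (pushforward mu s) A.
  apply: (lebesgue_measure_unique (mu := mscale (NngNum cge0) (pushforward mu s))).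
  move=> _ [[a b]/= _ <-].
  rewrite /mscale/= /pushforward (_ : s @^-1` _ = `]a / c, b / c]%classic).
    rewrite !lebesgue_measure_itv/= !lte_fin ltr_pM2r ?invr_gt0//.
    case: ifPn => _; last by rewrite mule0.
    by rewrite -!EFinB -EFinM -mulrBl mulrC divfK// gt_eqF.
  apply/seteqP; split => x; rewrite /s /= !in_itv/=;
    by rewrite ltr_pdivrMr// ler_pdivlMr// mulrC.
rewrite [in RHS](@eq_measure_integral _ _ _ _ (mscale (NngNum cge0) (pushforward mu s))).
  rewrite ge0_integral_mscale// ge0_integral_pushforward//.
  by rewrite preimage_setT /= muleA -EFinM mulVf ?gt_eqF// mul1e.
by move=> A mA _; exact: E.
Qed.

Lemma cons_rV_scale n c (x : R) (v : 'rV[R]_n) :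
  c *: cons_rV (x, v) = cons_rV (c * x, c *: v).
Proof.
apply/rowP => i; rewrite mxE; have [j|j] := @split_ordP 1 n i => ->.
  rewrite (_ : lshift n j = 0); last by apply: val_inj; rewrite ord1.
  by rewrite !cons_rV0.
by rewrite !cons_rV_rshift mxE.
Qed.

Lemma measurable_scale_rV n (c : R) :
  measurable_fun setT (fun v : 'rV[R]_n => c *: v).
Proof.
apply: measurable_fun_rV => i; under eq_fun do rewrite mxE.
by apply: measurable_funM => //; exact: measurable_coord.
Qed.

Lemma ge0_integral_scale_rV n (c : R) (f : 'rV[R]_n -> \bar R) : 0 < c ->
  measurable_fun setT f -> (forall x, 0 <= f x)%E ->
  (\int[lebesgue_rV]_v f (c *: v)%R = (c ^- n)%:E * \int[lebesgue_rV]_v f v)%E.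
Proof.
move=> c0; elim: n f => [|n IHn] f mf f0.
  rewrite expr0 invr1 mul1e; apply: eq_integral => v _; congr f.
  by apply/rowP => -[].
have cn0 : 0 <= c ^- n by rewrite invr_ge0 exprn_ge0// ltW.
have mfc : measurable_fun setT (fun v : 'rV[R]_n.+1 => f (c *: v)).
  by apply: measurableT_comp => //; exact: measurable_scale_rV.
rewrite ge0_integral_rVS// [in RHS]ge0_integral_rVS//.
have mfx x : measurable_fun setT (fun v : 'rV[R]_n => f (cons_rV (x, v))).
  apply: measurableT_comp => //; apply: measurableT_comp.
    exact: measurable_cons_rV.
  exact: measurable_pair1.
under eq_integral => x _.
  under eq_integral do rewrite cons_rV_scale.
  rewrite (IHn (fun v => f (cons_rV (c * x, v))))//.
  over.
pose F x := (\int[lebesgue_rV]_v f (cons_rV (x, v)))%E.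
have mF : measurable_fun setT F.
  apply: (@measurable_fun_fubini_tonelli_F _ _ (measurableTypeR R) _ R
    (@lebesgue_rV R n) (f \o @cons_rV R n)); last by move=> p; exact: f0.
  by apply: measurableT_comp => //; exact: measurable_cons_rV.
have F0 x : (0 <= F x)%E by exact: integral_ge0.
have mFc : measurable_fun setT (fun x : measurableTypeR R => F (c * x)).
  by apply: (measurableT_comp mF); exact: mulrl_measurable.
rewrite (ge0_integralZl _ measurableT mFc (fun x _ => F0 (c * x))); last first.
  by rewrite lee_fin.
rewrite (ge0_integral_scale1 c0 mF)// muleA -EFinM.
by rewrite exprSr invfM.
Qed.

Definition sqnorm n (v : 'rV[R]_n) : R := \sum_i v 0 i ^+ 2.

Lemma sqnorm_ge0 n (v : 'rV[R]_n) : 0 <= sqnorm v.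
Proof. by apply: sumr_ge0 => i _; rewrite sqr_ge0. Qed.

Lemma sqnorm_cons n (x : R) (v : 'rV[R]_n) :
  sqnorm (cons_rV (x, v)) = x ^+ 2 + sqnorm v.
Proof.
rewrite /sqnorm big_ord_recl cons_rV0/=; congr (_ + _); apply: eq_bigr => i _.
by rewrite (_ : lift ord0 i = rshift 1 i) ?cons_rV_rshift//; exact: val_inj.
Qed.

Lemma sqnormZ n (c : R) (v : 'rV[R]_n) : sqnorm (c *: v) = c ^+ 2 * sqnorm v.
Proof.
by rewrite /sqnorm mulr_sumr; apply: eq_bigr => i _; rewrite mxE exprMn.
Qed.

Lemma measurable_sqnorm n : measurable_fun setT (@sqnorm n).
Proof.
apply: measurable_sum => i; apply: measurable_funX; exact: measurable_coord.
Qed.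

Lemma integral_gauss_rV n :
  (\int[lebesgue_rV]_v (expR (- @sqnorm n v))%:E = (Num.sqrt pi ^+ n)%:E)%E.
Proof.
have mg m : measurable_fun setT (fun v : 'rV[R]_m => (expR (- sqnorm v))%:E).
  apply/measurable_EFinP; apply: measurableT_comp => //.
  by apply: measurableT_comp => //; exact: measurable_sqnorm.
elim: n => [|n IHn].
  rewrite [LHS](integral_dirac (0 : 'rV[R]_0) measurableT (mg 0%N)).
  by rewrite diracE mem_set// mul1e /sqnorm big_ord0 oppr0 expR0.
rewrite (ge0_integral_rVS (mg n.+1)); last by move=> v; rewrite lee_fin expR_ge0.
under eq_integral => x _.
  under eq_integral do rewrite sqnorm_cons opprD expRD EFinM.
  rewrite (ge0_integralZl _ measurableT (mg n)); last 2 first.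
    by move=> v _; rewrite lee_fin expR_ge0.
    by rewrite lee_fin expR_ge0.
  rewrite IHn.
  over.
rewrite ge0_integralZr//; last first.
- by apply/measurable_EFinP; exact: measurable_gauss_fun.
by rewrite integralT_gauss exprS EFinM.
Qed.

End measure_rV.

(** * Sums over a lattice as integrals over cubic cells *)

Section lattice_sum.
Context {R : realType}.

Definition cube n (a : 'rV[R]_n) (h : R) : set 'rV[R]_n :=
  [set v | forall i, v 0 i \in `[a 0 i, a 0 i + h[].

Lemma measurable_cube n (a : 'rV[R]_n) h : measurable (cube a h).
Proof. exact: measurable_coords_itv. Qed.

Lemma lebesgue_rV_cube n (a : 'rV[R]_n) h : 0 < h ->
  lebesgue_rV (cube a h) = (h ^+ n)%:E.
Proof.
move=> h0; elim: n a => [|n IHn] a.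
  by rewrite expr0 [LHS]diracE mem_set//= => -[].
pose a' : 'rV[R]_n := @rsubmx R 1 1 n a.
have a'E i : a' 0 i = a 0 (@rshift 1 n i) by rewrite mxE.
rewrite /= /lebesgue_rV_step /pushforward.
rewrite (_ : @cons_rV R n @^-1` _ = `[a 0 0, a 0 0 + h[ `*` cube a' h); last first.
  apply/seteqP; split => -[x v] /=.
    move=> H; split => [|i]; first by have := H 0; rewrite cons_rV0.
    by have := H (@rshift 1 n i); rewrite cons_rV_rshift a'E.
  move=> [Hx Hv] i; have [j|j] := @split_ordP 1 n i => ->.
    by rewrite (_ : lshift n j = 0) ?cons_rV0//; apply: val_inj; rewrite ord1.
  by have := Hv j; rewrite cons_rV_rshift a'E.
rewrite exprS EFinM -(IHn a').
have <- : lebesgue_measure (`[a 0 0, a 0 0 + h[%classic : set R) = h%:E.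
  by rewrite lebesgue_measure_itv/= lte_fin ltrDl h0 -EFinB addrC addKr.
by apply: product_measure1E => //; exact: measurable_cube.
Qed.

Context {d N : nat}.
Local Notation torus := {ffun 'I_d -> 'I_N}.

Definition lattice_point (a h : R) (n : torus) : 'rV[R]_d :=
  \row_i (a + h * (n i)%:R).

Local Notation cell a h n := (cube (lattice_point a h n) h).

Lemma cell_inj a h (n m : torus) v : 0 < h -> cell a h n v -> cell a h m v -> n = m.
Proof.
move=> h0 nv mv; apply/ffunP => i; apply/val_inj => /=.
move: (nv i) (mv i); rewrite !mxE !in_itv/= => /andP[n1 n2] /andP[m1 m2].
have n12 : (n i)%:R < (m i)%:R + 1 :> R by rewrite -(ltr_pM2l h0) mulrDr; lra.
have m12 : (m i)%:R < (n i)%:R + 1 :> R by rewrite -(ltr_pM2l h0) mulrDr; lra.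
by move: n12 m12; rewrite !natr1 !ltr_nat !ltnS => ? ?; apply/eqP; rewrite eqn_leq; apply/andP.
Qed.

(** Cells are disjoint and have measure h^d, so the left-hand side is the
    integral of the step function equal to [f n] on the cell of n. *)
Lemma lattice_sum_le (a h : R) (D : set 'rV[R]_d) (f : torus -> R)
    (F : 'rV[R]_d -> R) : 0 < h -> measurable D -> measurable_fun D F ->
  (forall v, D v -> 0 <= F v) -> (forall n, 0 <= f n) ->
  (forall n, f n != 0 -> cell a h n `<=` D) ->
  (forall n v, cell a h n v -> D v -> f n <= F v) ->
  ((h ^+ d * \sum_n f n)%:E <= \int[lebesgue_rV]_(v in D) (F v)%:E)%E.
Proof.
move=> h0 mD mF F0 f0 fD fF.
pose G v := \sum_n f n * \1_(cell a h n) v.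
have mI n : measurable_fun D (fun v => f n * \1_(cell a h n) v : R).
  apply: measurable_funM => //; apply: measurable_funTS.
  exact: measurable_indic (measurable_cube _ _).
have -> : (h ^+ d * \sum_n f n)%:E = (\int[lebesgue_rV]_(v in D) (G v)%:E)%E.
  under eq_integral do rewrite -sumEFin.
  rewrite ge0_integral_sum//; last 2 first.
    by move=> n; exact/measurable_EFinP.
    by move=> n v _; rewrite lee_fin mulr_ge0.
  rewrite mulr_sumr -sumEFin; apply: eq_bigr => n _.
  have [fn0|fn0] := eqVneq (f n) 0.
    by rewrite fn0 mulr0 integral0_eq// => v _; rewrite mul0r.
  under eq_integral do rewrite EFinM.
  rewrite ge0_integralZl//; last 2 first.
    apply/measurable_EFinP; apply: measurable_funTS.
    exact: measurable_indic (measurable_cube _ _).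
    by rewrite lee_fin.
  rewrite integral_indic//; last exact: measurable_cube.
  rewrite setIidl; last exact: fD.
  rewrite mulrC EFinM; congr (_ * _)%E; apply/esym.
  exact: lebesgue_rV_cube.
apply: ge0_le_integral => //.
- by move=> v _; rewrite lee_fin sumr_ge0// => n _; rewrite mulr_ge0.
- by apply/measurable_EFinP; apply: measurable_sum => n.
- exact/measurable_EFinP.
move=> v Dv; rewrite lee_fin /G.
have [[n nv]|nv] := pselect (exists n, cell a h n v).
  rewrite (bigD1 n)//= big1 ?addr0.
    by rewrite indicE mem_set// mulr1; exact: fF.
  move=> m mn; rewrite indicE memNset ?mulr0// => mv.
  by move/eqP: mn; apply; exact: cell_inj mv nv.
rewrite big1; first exact: F0.
by move=> n _; rewrite indicE memNset ?mulr0// => nv'; apply: nv; exists n.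
Qed.

End lattice_sum.

(** * The phase space integral and the Gamma function *)

Section phase_space_integral.
Context {R : realType}.
Local Notation mu := (@lebesgue_measure R).

Lemma cvg_mulr_expRN : (x * expR (- x) : R) @[x --> +oo] --> (0 : R).
Proof.
apply/cvgrPdist_le => e e0; near=> x.
have x0 : 0 < x by near: x; exact: nbhs_pinfty_gt.
have xe : 2 / e <= x by near: x; apply: nbhs_pinfty_ge; exact: num_real.
rewrite sub0r normrN ger0_norm ?mulr_ge0 ?expR_ge0 ?(ltW x0)//.
rewrite expRN ler_pdivrMr ?expR_gt0//.
have := expR_ge1Dxn 1 (ltW x0).
move: xe; rewrite ler_pdivrMr// => xe E.
apply: (@le_trans _ _ (e * (1 + x ^+ 2 / 2))); last by rewrite ler_pM2l.
by nra.
Unshelve. all: end_near. Qed.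

(** An antiderivative of (t - s) exp(-t) is - (t - s + 1) exp(-t). *)
Lemma integral_tail (s : R) :
  (\int[mu]_(t in `[s, +oo[) ((t - s) * expR (- t))%:E = (expR (- s))%:E)%E.
Proof.
pose F (t : R) := - ((t * expR (- t)) + (1 - s) * expR (- t)).
have dF (x : R) : is_derive x 1 F ((x - s) * expR (- x)).
  by rewrite /F; apply: is_derive_eq; rewrite /GRing.scale/=; ring.
rewrite (@ge0_continuous_FTC2y _ _ F s 0).
- by rewrite /F sub0e -EFinN opprK; congr EFin; ring.
- by move=> x sx; rewrite mulr_ge0 ?expR_ge0// subr_ge0.
- apply: continuous_subspaceT => x; apply: cvgM.
    by apply: cvgB; [exact: cvg_id|exact: cvg_cst].
  apply: continuous_comp; first exact: opp_continuous.
  exact: continuous_expR.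
- rewrite -[X in _ --> X]oppr0; apply: cvgN; rewrite -[X in _ --> X]addr0.
  apply: cvgD; first exact: cvg_mulr_expRN.
  by rewrite -[X in _ --> X](mulr0 (1 - s)); apply: cvgMr; exact: cvgr_expR.
- by move=> x _; apply: ex_derive.
- apply: cvg_at_right_filter; apply: differentiable_continuous.
  by apply/derivable1_diffP; apply: ex_derive.
- by move=> x _; rewrite derive1E; apply: derive_val.
Qed.

Lemma integral_riesz_expRN (s : R) : 0 <= s ->
  (\int[mu]_t (Num.max 0 (t - s) * expR (- t))%:E = (expR (- s))%:E)%E.
Proof.
move=> s0; rewrite -(integral_tail s) [in RHS]integral_mkcond.
apply: eq_integral => t _; rewrite patchE.
case: ifPn => [|]; first by rewrite inE/= in_itv/= andbT => st; rewrite max_r// subr_ge0.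
rewrite notin_setE/= in_itv/= andbT => /negP; rewrite -ltNge => ts.
by rewrite max_l ?mul0r// subr_le0 ltW.
Qed.

(** The integral of (1 - |v|^2)_+, that is (2 pi)^d times the classical constant
    for Riesz means of order 1 (Lcl_riesz_volume). *)
Definition riesz_volume n : \bar R :=
  (\int[lebesgue_rV]_v (Num.max 0 (1 - @sqnorm R n v))%:E)%E.

Lemma measurable_riesz n (z c : R) :
  measurable_fun setT (fun v => (Num.max 0 (z - c * @sqnorm R n v))%:E).
Proof.
apply/measurable_EFinP; apply: measurable_maxr => //.
apply: measurable_funB => //; apply: measurable_funM => //.
exact: measurable_sqnorm.
Qed.

Lemma integral_riesz n (z c : R) : 0 < z -> 0 < c ->
  (\int[lebesgue_rV]_v (Num.max 0 (z - c * @sqnorm R n v))%:E =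
   (z * (z / c) `^ (n%:R / 2))%:E * riesz_volume n)%E.
Proof.
move=> z0 c0.
have cz0 : 0 < Num.sqrt (c / z) by rewrite sqrtr_gt0 divr_gt0.
have m1 : measurable_fun setT (fun v => (Num.max 0 (1 - @sqnorm R n v))%:E).
  by have := @measurable_riesz n 1 1; under eq_fun do rewrite mul1r.
have E : (\int[lebesgue_rV]_v (Num.max 0 (1 - c / z * @sqnorm R n v))%:E =
    (Num.sqrt (c / z) ^- n)%:E * riesz_volume n)%E.
  rewrite -(ge0_integral_scale_rV cz0 m1); last first.
    by move=> v; rewrite lee_fin le_max lexx.
  by apply: eq_integral => v _; rewrite sqnormZ sqr_sqrtr ?divr_ge0 ?ltW.
transitivity (z%:E * \int[lebesgue_rV]_v
   (Num.max 0 (1 - c / z * @sqnorm R n v))%:E)%E.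
  rewrite -ge0_integralZl//.
  - apply: eq_integral => v _; rewrite -EFinM; congr EFin.
    rewrite maxr_pMr ?ltW// mulr0; congr Num.max; field.
    by rewrite gt_eqF.
  - exact: measurable_riesz.
  - by move=> v _; rewrite lee_fin le_max lexx.
  - by rewrite lee_fin ltW.
rewrite E muleA -EFinM -/(riesz_volume n); congr (_%:E * _)%E; congr (_ * _).
have -> : z / c = (c / z)^-1 by rewrite invf_div.
rewrite -powR12_sqrt ?divr_ge0 ?ltW// -powR_mulrn ?powR_ge0//. rewrite -(powRrM (c / z)) -powRN.
rewrite -(@powR_inv1 _ (c / z)) ?divr_ge0 ?ltW// -powRrM; congr (_ `^ _).
by rewrite mulN1r [2^-1 * _]mulrC.
Qed.

(** Both sides equal the double integral of (t - |v|^2)_+ exp(-t): integrating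
    first over v gives a multiple of t^(1 + n/2) exp(-t) by scaling, integrating
    first over t gives exp(-|v|^2). *)
Lemma riesz_volume_Gamma n :
  (riesz_volume n *
   \int[mu]_(t in `]0%R, +oo[) (t `^ (1 + n%:R / 2) * expR (- t))%:E =
  (Num.sqrt pi ^+ n)%:E)%E.
Proof.
rewrite -integral_gauss_rV.
have vol0 : (0 <= riesz_volume n)%E.
  by apply: integral_ge0 => v _; rewrite lee_fin le_max lexx.
pose f (p : measurableTypeR R * 'rV[R]_n) :=
  (Num.max 0 (p.1 - sqnorm p.2) * expR (- p.1))%:E.
have f0 p : (0 <= f p)%E.
  by rewrite lee_fin mulr_ge0 ?expR_ge0// le_max lexx.
have mf : measurable_fun setT f.
  apply/measurable_EFinP; apply: measurable_funM.
    apply: measurable_maxr => //; apply: measurable_funB => //.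
    by apply: measurableT_comp => //; exact: measurable_sqnorm.
  by apply: measurableT_comp => //; apply: measurableT_comp.
have mt (t : R) : measurable_fun setT (fun v => (Num.max 0 (t - @sqnorm R n v))%:E).
  by have := @measurable_riesz n t 1; under eq_fun do rewrite mul1r.
have It t : 0 < t -> (\int[lebesgue_rV]_v (Num.max 0 (t - @sqnorm R n v))%:E =
    (t * t `^ (n%:R / 2))%:E * riesz_volume n)%E.
  move=> t0; have := @integral_riesz n t 1 t0 ltr01; rewrite divr1 => <-.
  by apply: eq_integral => v _; rewrite mul1r.
have := @fubini_tonelli _ _ (measurableTypeR R) _ R mu (@lebesgue_rV R n) f mf f0.
rewrite /fubini_F /fubini_G /f /=.
under [X in _ = X -> _]eq_integral do rewrite integral_riesz_expRN ?sqnorm_ge0//.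
move=> <-; rewrite -ge0_integralZl//; last 2 first.
  apply/measurable_EFinP; apply: measurable_funM.
    by apply: measurable_funTS; exact: measurable_powR.
  by apply: measurable_funTS; apply: measurableT_comp.
  by move=> t _; rewrite lee_fin mulr_ge0 ?powR_ge0 ?expR_ge0.
rewrite integral_mkcond; apply: eq_integral => t _; rewrite patchE.
case: ifPn => [|]; rewrite ?inE ?notin_setE/= in_itv/= andbT.
  move=> t0.
  under eq_integral do rewrite EFinM.
  rewrite (ge0_integralZr _ measurableT (mt t)); last 2 first.
    by move=> v _; rewrite lee_fin le_max lexx.
    by rewrite lee_fin expR_ge0.
  rewrite It// muleAC muleC -EFinM; congr (_%:E * _)%E; congr (_ * _).
  by rewrite powRD ?powRr1 ?ltW// gt_eqF ?implybT.
move=> /negP; rewrite -leNgt => t0.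
rewrite [RHS]integral0_eq// => v _; rewrite max_l ?mul0r//.
by have := sqnorm_ge0 v; lra.
Qed.
End phase_space_integral.

(** * The symbol of the discrete Laplacian *)

Section lattice_symbol.
Context {R : realType}.

Lemma is_derive_ge0_le (f df : R -> R) (b : R) : 0 <= b ->
  (forall x : R, is_derive x 1 f (df x)) ->
  (forall x, 0 <= x <= b -> 0 <= df x) -> f 0 <= f b.
Proof.
move=> b0 fdf df0.
have cf : {within `[0, b], continuous f}.
  apply: continuous_subspaceT => x; apply: differentiable_continuous.
  by apply/derivable1_diffP; apply: ex_derive.
have [x] := MVT_segment b0 (fun x _ => fdf x) cf.
rewrite in_itv/= => /df0 dfx E.
by rewrite -subr_ge0 E mulr_ge0 ?subr0.
Qed.

(** The cosine is at least c on all of [0, x]; integrating twice gives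
    sin t >= c t and then 2 (1 - cos x) >= c x^2. *)
Lemma cos_symbol_ge (c x : R) : `|x| <= pi -> c <= cos x ->
  c * x ^+ 2 <= 2 * (1 - cos x).
Proof.
move=> xpi cx; rewrite -[cos x]cos_norm -(real_normK (num_real x)).
rewrite -cos_norm in cx; have x0 := normr_ge0 x.
set y := `|x| in xpi cx x0 *; clearbody y; clear x; rename y into x.
have cosge t : 0 <= t <= x -> c <= cos t.
  move=> /andP[t0 tx]; apply: (le_trans cx).
  by rewrite le_eqVlt; have [->|tnx] := eqVneq t x; rewrite ?eqxx//;
    rewrite ltr_cos ?in_itv/= ?t0 ?x0 ?xpi ?(le_trans tx) ?orbT// lt_neqAle tnx tx orbT.
have singe t : 0 <= t <= x -> c * t <= sin t.
  move=> /andP[t0 tx].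
  have := @is_derive_ge0_le (fun t => sin t - c * t) (fun t => cos t - c) t t0.
  rewrite sin0 mulr0 subr0 subr_ge0; apply.
    by move=> y; apply: is_derive_eq; rewrite /GRing.scale/=; ring.
  move=> y /andP[y0 yt]; rewrite subr_ge0 cosge// y0; exact: le_trans tx.
have := @is_derive_ge0_le (fun t => 2 * (1 - cos t) - c * t ^+ 2)
  (fun t => 2 * (sin t - c * t)) x x0.
rewrite cos0 subrr mulr0 expr0n mulr0 subr0 subr_ge0; apply.
  by move=> y; apply: is_derive_eq; rewrite /GRing.scale/=; ring.
by move=> y yx; rewrite mulr_ge0// subr_ge0 singe.
Qed.

Context {d M : nat}.
Local Notation N := (M.*2.+1).
Local Notation torus := {ffun 'I_d -> 'I_N}.

Lemma freq_le_pi (k : torus) i : `|freq M k i| <= pi :> R.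
Proof.
rewrite /freq normf_div normrM normr_nat ler_pdivrMr ?ltr0n//.
rewrite gtr0_norm ?mulr_gt0 ?pi_gt0// [2 * _]mulrC -mulrA ler_pM2l ?pi_gt0//.
have : (k i)%:R <= M%:R + M%:R :> R by rewrite -natrD ler_nat addnn -ltnS.
have : 0 <= (k i)%:R :> R by [].
have -> : N%:R = 2 * M%:R + 1 :> R by rewrite -natr1 -addnn natrD; ring.
move=> k0 kM; have : `|(k i)%:R - M%:R| <= M%:R :> R by rewrite ler_norml; lra.
lra.
Qed.

(** For a fine mesh, a frequency at which some cosine is below c has a symbol
    above z and contributes nothing; at the other frequencies cos_symbol_ge
    applies in each coordinate. *)
Lemma symbol_max_le (c z h : R) (k : torus) : 0 < h ->
  z * h ^+ 2 <= 2 * (1 - c) ->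
  Num.max 0 (z - \sum_i 2 * (1 - cos (freq M k i)) / h ^+ 2) <=
  Num.max 0 (z - c * \sum_i (freq M k i / h) ^+ 2).
Proof.
move=> h0 zh; have h20 : 0 < h ^+ 2 by rewrite exprn_gt0.
have term0 i : 0 <= 2 * (1 - cos (freq M k i)) / h ^+ 2.
  by rewrite divr_ge0 ?mulr_ge0 ?subr_ge0 ?cos_le1// ltW.
have [/forallP call|/forallPn[i ci]] := boolP [forall i, c <= cos (freq M k i)].
  rewrite ge_max !le_max lexx/=; apply/orP; right.
  rewrite lerD2l lerN2 mulr_sumr; apply: ler_sum => i _.
  rewrite expr_div_n mulrA ler_pM2r ?invr_gt0//.
  by apply: cos_symbol_ge => //; exact: freq_le_pi.
rewrite [leLHS]max_l ?le_max ?lexx// subr_le0 (bigD1 i)//=.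
apply: (@le_trans _ _ (2 * (1 - cos (freq M k i)) / h ^+ 2)).
  rewrite ler_pdivlMr//; apply: (le_trans zh).
  by move: ci; rewrite -ltNge => ci; lra.
by rewrite lerDl sumr_ge0.
Qed.

Lemma lattice_freqE (h w : R) (k : torus) : h != 0 ->
  w = 2 * pi / (N%:R * h) ->
  \sum_i (freq M k i / h) ^+ 2 = sqnorm (lattice_point (- (w * M%:R)) w k).
Proof.
move=> h0 wE; apply: eq_bigr => i _; rewrite mxE; congr (_ ^+ 2).
have N0 : N%:R != 0 :> R by rewrite pnatr_eq0.
rewrite /freq wE; move: N%:R N0 => n n0; field; exact/andP.
Qed.

(** The frequencies form a lattice of mesh w.  On the cell of a lattice point xi,
    |v|^2 <= (1 + w) (|xi|^2 + d w), which replaces the lattice point by the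
    variable of integration at the price of slightly worse constants, and the
    lattice sum becomes an integral. *)
Lemma freq_sum_le (c z h w : R) : 0 < c -> 0 < z -> 0 < h ->
  z * h ^+ 2 <= 2 * (1 - c) -> w = 2 * pi / (N%:R * h) ->
  ((w ^+ d * \sum_(k : torus)
     Num.max 0 (z - \sum_i 2 * (1 - cos (freq M k i)) / h ^+ 2))%:E <=
   ((z + c * d%:R * w) * ((z + c * d%:R * w) / (c / (1 + w))) `^ (d%:R / 2))%:E *
   @riesz_volume R d)%E.
Proof.
move=> c0 z0 h0 zh wE.
have w0 : 0 < w by rewrite wE divr_gt0 ?mulr_gt0 ?pi_gt0.
have w1 : 0 < 1 + w by lra.
have zz : 0 < z + c * d%:R * w.
  by rewrite ltr_wpDr// mulr_ge0 ?mulr_ge0// ltW.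
rewrite -integral_riesz ?divr_gt0//.
apply: (@lattice_sum_le _ _ _ (- (w * M%:R))) => //.
- by have /measurable_EFinP := @measurable_riesz R d (z + c * d%:R * w) (c / (1 + w)).
- by move=> v _; rewrite le_max lexx.
- by move=> k; rewrite le_max lexx.
move=> k v kv _; apply: (le_trans (symbol_max_le _ h0 zh)).
rewrite (lattice_freqE _ _ wE) ?gt_eqF//; set xi := lattice_point _ _ _ in kv *.
rewrite ge_max !le_max lexx/=; apply/orP; right.
suff : sqnorm v <= (1 + w) * (sqnorm xi + d%:R * w).
  move=> vxi; have : c / (1 + w) * sqnorm v <= c * (sqnorm xi + d%:R * w).
    by rewrite -mulrA ler_pM2l// ler_pdivrMl.
  by lra.
rewrite /sqnorm mulrDr !mulr_sumr.
have -> : (1 + w) * (d%:R * w) = \sum_(i < d) (1 + w) * w.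
  by rewrite sumr_const card_ord -mulr_natl; ring.
rewrite -big_split/=; apply: ler_sum => i _.
have := kv i; rewrite in_itv/= => /andP[v1 v2].
set x := xi 0 i in v1 v2 *; set y := v 0 i in v1 v2 *.
have e1 : 0 <= y - x by lra.
have e2 : y - x <= w by lra.
have -> : y = x + (y - x) by ring.
move: (y - x) e1 e2 => e e1 e2.
have e3 : e ^+ 2 <= w ^+ 2 by rewrite ler_pXn2r// nnegrE ltW.
(* w x^2 + e^2 / w >= 2 x e, and e <= w. *)
have e4 : 2 * x * e <= w * x ^+ 2 + w.
  apply: (@le_trans _ _ (w * x ^+ 2 + w^-1 * e ^+ 2)).
    rewrite -subr_ge0 [leRHS](_ : _ = w^-1 * (w * x - e) ^+ 2); last first.
      by field; rewrite gt_eqF.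
    by rewrite mulr_ge0 ?sqr_ge0// invr_ge0 ltW.
  by rewrite lerD2l ler_pdivrMl// -expr2.
by rewrite sqrrD; lra.
Qed.

End lattice_symbol.

(** * Continuous functions with compact support *)

Section compact_support.
Context {R : realType} {n : nat}.
Implicit Types (K U : set 'rV[R]_n) (g : 'rV[R]_n -> R).

Lemma compact_ball_subset K U : compact K -> open U -> K `<=` U ->
  \forall e \near (0:R)^'+, forall x, K x -> ball x e `<=` U.
Proof.
move=> /compact_near_coveringP/(_ _ _ (fun e x => ball x e `<=` U)) cK oU KU.
apply: cK => x Kx.
have /nbhs_ballP[r /= r0 xrU] : nbhs x U by apply: open_nbhs_nbhs; split => //; exact: KU.
exists (ball x (r / 2), [set e | e < r / 2]) => /=.
  by split; [apply: nbhsx_ballx; rewrite divr_gt0|apply: nbhs_right_lt; rewrite divr_gt0].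
move=> [y e]/= [xy er] v yv; apply: xrU; rewrite [r]splitr.
by apply: ball_triangle xy _; apply: le_ball yv; exact: ltW.
Qed.

(** Heine's theorem, by the covering form of compactness of K; when x is off K
    either y is in K and the roles are exchanged, or both values are 0. *)
Lemma compact_support_unif_continuous K g (eps : R) : compact K -> continuous g ->
  (forall x, ~ K x -> g x = 0) -> 0 < eps ->
  \forall e \near (0:R)^'+, forall x y, ball x e y -> `|g x - g y| <= eps.
Proof.
move=> /compact_near_coveringP/(_ _ _
  (fun e x => forall y, ball x e y -> `|g x - g y| <= eps)) cK cg g0 eps0.
have {}cK : \forall e \near (0:R)^'+, forall x, K x ->
    forall y, ball x e y -> `|g x - g y| <= eps.
  apply: cK => x Kx.
  have : \forall y \near x, `|g x - g y| <= eps / 2.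
    by move/cvgrPdist_le : (cg x); apply; rewrite divr_gt0.
  move=> /nbhs_ballP[r /= r0 xr].
  exists (ball x (r / 2), [set e | e < r / 2]) => /=.
    by split; [apply: nbhsx_ballx; rewrite divr_gt0|apply: nbhs_right_lt; rewrite divr_gt0].
  move=> [x' e]/= [xx' er] y x'y.
  have H1 : `|g x - g x'| <= eps / 2.
    by apply: xr; apply: le_ball xx'; rewrite ler_pdivrMr// ler_peMr ?ltW// ltr1n.
  have H2 : `|g x - g y| <= eps / 2.
    apply: xr; rewrite [r]splitr; apply: ball_triangle xx' _.
    by apply: le_ball x'y; exact: ltW.
  rewrite (_ : g x' - g y = (g x - g y) - (g x - g x')); last by ring.
  by rewrite (le_trans (ler_normB _ _))// [leRHS]splitr lerD.
apply: filterS cK => e Ke x y xy.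
have [Kx|Kx] := pselect (K x); first exact: Ke.
have [Ky|Ky] := pselect (K y).
  by rewrite distrC; apply: Ke => //; exact: ball_sym.
by rewrite !g0// subrr normr0 ltW.
Qed.

Lemma compact_support_bounded K g : compact K -> continuous g ->
  (forall x, ~ K x -> g x = 0) -> exists2 C : R, 0 <= C & forall x, `|g x| <= C.
Proof.
move=> cK cg g0.
have cgK : compact (g @` K).
  by apply: continuous_compact => //; exact: continuous_subspaceT.
have [C [_ /(_ (`|C| + 1)) Cb]] := compact_bounded cgK.
have C1 : C < `|C| + 1 by rewrite (le_lt_trans (ler_norm _))// ltrDl.
exists (`|C| + 1) => [|x]; first by rewrite addr_ge0.
have [Kx|/g0 ->] := pselect (K x); first by apply: Cb => //; exists x.
by rewrite normr0 addr_ge0.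
Qed.

End compact_support.

(** * Riemann sums *)

Section riemann_sums.
Context {R : realType} {d : nat}.
Local Notation mu := (@lebesgue_rV R d).

Lemma compact_support_integrable (K D : set 'rV[R]_d) (g : 'rV[R]_d -> R) :
  compact K -> continuous g -> (forall x, ~ K x -> g x = 0) ->
  measurable D -> (mu D < +oo)%E -> mu.-integrable D (EFin \o g).
Proof.
move=> cK cg g0 mD Doo; have [C C0 gC] := compact_support_bounded cK cg g0.
apply: measurable_bounded_integrable => //.
  by apply: measurable_funTS; exact: continuous_measurable_rV.
exists C; split; first exact: num_real.
by move=> M CM x _; exact: le_trans (gC x) (ltW CM).
Qed.

Lemma near_right_ex (P : R -> Prop) :
  (\forall e \near (0:R)^'+, P e) -> exists2 e, 0 < e & P e.
Proof.
move=> nP; have : \forall e \near (0:R)^'+, 0 < e /\ P e.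
  by near=> e; split; near: e => //; exact: nbhs_right_gt.
by move=> /filter_ex[e [? ?]]; exists e.
Unshelve. all: end_near. Qed.

Variables (L : R) (L_gt0 : 0 < L).

Definition mesh (M : nat) : R := L / M.*2.+1%:R.

Definition grid (M : nat) (n : {ffun 'I_d -> 'I_(M.*2.+1)}) : 'rV[R]_d :=
  lattice_point (- (L / 2)) (mesh M) n.

Definition box : set 'rV[R]_d := cube (\row_i (- (L / 2))) L.

Lemma mesh_gt0 M : 0 < mesh M.
Proof. by rewrite divr_gt0. Qed.

Lemma near_mesh (e : R) : 0 < e -> \forall M \near \oo, mesh M < e.
Proof.
move=> e0; near=> M.
rewrite /mesh ltr_pdivrMr// mulrC -ltr_pdivrMr//.
have LM : L / e <= M%:R by near: M; exact: nbhs_infty_ger.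
by rewrite (le_lt_trans LM)// ltr_nat ltnS -addnn leq_addr.
Unshelve. all: end_near. Qed.

Lemma grid_cell_box M (n : {ffun 'I_d -> 'I_(M.*2.+1)}) :
  cube (grid n) (mesh M) `<=` box.
Proof.
move=> v vn i; have := vn i; rewrite !mxE !in_itv/= => /andP[v1 v2].
have h0 := mesh_gt0 M.
have n0 : 0 <= mesh M * (n i)%:R by rewrite mulr_ge0// ltW.
have n1 : mesh M * ((n i)%:R + 1) <= L.
  rewrite natr1 -[leRHS](@divfK _ M.*2.+1%:R)// -/(mesh M) ler_pM2l//.
  by rewrite ler_nat.
by apply/andP; split; lra.
Qed.

Lemma measure_box : lebesgue_rV box = (L ^+ d)%:E.
Proof. exact: lebesgue_rV_cube. Qed.

(** Tagged Riemann sums, with tags allowed to leave their cell by one mesh: that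
    freedom is used for difference quotients, which are derivatives at an
    intermediate point.  One inequality suffices, since it applies to - g as well;
    a bound C of |g| is added to reduce to nonnegative functions. *)
Lemma riemann_sum_le (K Omega : set 'rV[R]_d) (g : 'rV[R]_d -> R) (eps : R) :
  compact K -> continuous g -> (forall x, ~ K x -> g x = 0) ->
  measurable Omega -> K `<=` Omega -> Omega `<=` box -> 0 < eps ->
  \forall M \near \oo, forall y : {ffun 'I_d -> 'I_(M.*2.+1)} -> 'rV[R]_d,
    (forall n, ball (grid n) (mesh M * 2) (y n)) ->
    mesh M ^+ d * \sum_n g (y n) <= \int[mu]_(x in Omega) g x + eps.
Proof.
move=> cK cg g0 mO KO Ob eps0.
have [C C0 gC] := compact_support_bounded cK cg g0.
have Ld0 : 0 < L ^+ d by rewrite exprn_gt0.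
(* The oscillation allowed per cell, so that the total error is eps. *)
pose eta := eps / L ^+ d.
have eta0 : 0 < eta by rewrite divr_gt0.
have [e e0 ge] := near_right_ex (compact_support_unif_continuous cK cg g0 eta0).
have mb : measurable box by exact: measurable_cube.
have boxoo : (mu box < +oo)%E by rewrite [X in (X < _)%E]measure_box ltry.
have ig : mu.-integrable box (EFin \o g) by exact: compact_support_integrable cK _ _ _ _.
have iOb : \int[mu]_(x in Omega) g x = \int[mu]_(x in box) g x.
  rewrite Rintegral_mkcond [RHS]Rintegral_mkcond; apply: eq_Rintegral => x _.
  rewrite !patchE; case: ifPn => [|]; rewrite ?inE ?notin_setE => xO.
    by rewrite mem_set//; exact: Ob.
  by case: ifPn => // _; rewrite g0// => /KO.
near=> M => y yn.
have h0 := mesh_gt0 M.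
have he : mesh M * 3 < e.
  by rewrite -ltr_pdivlMr//; near: M; apply: near_mesh; rewrite divr_gt0.
have mg : measurable_fun box g.
  by apply: measurable_funTS; exact: continuous_measurable_rV.
have : ((mesh M ^+ d * \sum_n (g (y n) + C))%:E <=
    \int[mu]_(v in box) (g v + (C + eta))%:E)%E.
  apply: (lattice_sum_le (a := - (L / 2))) => //.
  - exact: measurable_funD.
  - by move=> v _; have := gC v; rewrite ler_norml => /andP[? _]; lra.
  - by move=> n; have := gC (y n); rewrite ler_norml => /andP[? _]; lra.
  - by move=> n _; exact: grid_cell_box.
  move=> n v nv _.
  have : `|g v - g (y n)| <= eta.
    apply: ge; apply: le_ball (ltW he) _ _.
    rewrite (_ : mesh M * 3 = mesh M + mesh M * 2); last by ring.
    apply: ball_triangle (yn n); apply: ball_sym; split=> // i j.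
    have := nv j; rewrite (ord1 i) !mxE in_itv/= => /andP[v1 v2].
    by rewrite /ball/= ltr_distlC; apply/andP; split; rewrite ?mxE; lra.
  by rewrite ler_distlC => /andP[? ?]; lra.
under eq_integral do rewrite EFinD.
rewrite integralD//=; last first.
  by apply: measurable_bounded_integrable => //; exact: bounded_cst.
have -> : (\int[mu]_(x in box) (C + eta)%:E = ((C + eta) * L ^+ d)%:E)%E.
  rewrite -[LHS]/(\int[mu]_(x in box) (cst (C + eta)%:E x))%E integral_cst//.
  by rewrite EFinM; congr (_ * _)%E; exact: measure_box.
have -> : (\int[mu]_(x in box) (g x)%:E = (\int[mu]_(x in Omega) g x)%:E)%E.
  by rewrite iOb /Rintegral fineK//; exact: integrable_fin_num.
rewrite -EFinD lee_fin big_split/= sumr_const card_ffun !card_ord mulrDr.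
have -> : mesh M ^+ d * (C *+ (M.*2.+1 ^ d)) = L ^+ d * C.
  rewrite -mulr_natr mulrCA natrX -exprMn mulrC /mesh divfK//.
rewrite [(C + eta) * _]mulrDl [eta * _]divfK ?gt_eqF//.
by lra.
Unshelve. all: end_near. Qed.

End riemann_sums.

(** * Sampling of test functions *)

Section test_functions.
Context {R : realType} {d : nat}.
Local Notation mu := (@lebesgue_rV R d).
Local Notation e_ i := (delta_mx 0 i : 'rV[R]_d).

Section one_function.
Variables (Omega : set 'rV[R]_d) (phi : 'rV[R]_d -> R).
Hypothesis tphi : test_function Omega phi.
Local Notation K := (closure [set x | phi x != 0]).

Lemma test_function_compact : compact K.
Proof. by have [] := tphi. Qed.

Lemma test_function_sub : K `<=` Omega.
Proof. by have [] := tphi. Qed.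

Lemma test_function_continuous : continuous phi.
Proof. by have [/(_ [::])[]] := tphi. Qed.

Lemma test_function_derivable i x : derivable phi x (e_ i).
Proof. by have [/(_ [::])[_ +] _ _] := tphi; apply. Qed.

Lemma partial_continuous i : continuous (partial i phi).
Proof. by have [/(_ [:: i])[]] := tphi. Qed.

Lemma test_function_eq0 x : ~ K x -> phi x = 0.
Proof.
by apply: contra_notP => /eqP p0; apply: subset_closure.
Qed.

Lemma test_function_eq0_out x : ~ Omega x -> phi x = 0.
Proof. by move=> Ox; apply: test_function_eq0 => /test_function_sub. Qed.

(** Off the closed support the function vanishes in a neighbourhood. *)
Lemma partial_eq0 i x : ~ K x -> partial i phi x = 0.
Proof.
move=> Kx; have cK : closed K by exact: closed_closure.
have nK : \forall y \near x, ~ K y.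
  by apply: open_nbhs_nbhs; split => //; exact: closed_openC.
rewrite /partial (@near_eq_derive _ _ _ phi (cst 0)).
- exact: derive_cst.
- by apply: filterS nK => y /test_function_eq0.
Qed.

Lemma partial_mean_value i x (h : R) : 0 < h -> exists2 s, 0 <= s <= h &
  phi (x + h *: e_ i) - phi x = h * partial i phi (x + s *: e_ i).
Proof.
move=> h0; pose f t := phi (x + t *: e_ i).
have df t : is_derive t (1:R) f (partial i phi (x + t *: e_ i)).
  have E : (fun h => h^-1 *: ((f \o shift t) (h *: 1) - f t)) =
      (fun h => h^-1 *: ((phi \o shift (x + t *: e_ i)) (h *: e_ i) -
                           phi (x + t *: e_ i))).
    apply/funext => u; rewrite /f /= ; congr (_ *: (phi _ - _)).
    by rewrite scalerDl /GRing.scale/= mulr1 addrCA.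
  split.
    by rewrite /derivable E; exact: test_function_derivable.
  by rewrite /derive E.
have cf : {within `[0, h], continuous f}.
  apply: continuous_subspaceT => y; apply: differentiable_continuous.
  by apply/derivable1_diffP; apply: ex_derive.
have [s] := MVT_segment (ltW h0) (fun t _ => df t) cf.
rewrite in_itv/= => sh E; exists s => //.
by move: E; rewrite /f scale0r addr0 subr0 mulrC.
Qed.

End one_function.

Variables (Omega : set 'rV[R]_d).
Hypotheses (Omega_open : open Omega).
Variables (L : R) (L_gt0 : 0 < L).
Hypothesis Omega_box : forall v, Omega v -> forall i, - (L / 2) < v 0 i < L / 2.
Local Notation h := (mesh L).

Lemma sub_box : Omega `<=` box L.
Proof.
move=> v /Omega_box vb i; rewrite !mxE in_itv/=.
by have /andP[? ?] := vb i; apply/andP; split; lra.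
Qed.

Lemma sub_box_measure_fin : (mu Omega < +oo)%E.
Proof.
have mO := open_measurable_rV Omega_open.
apply: (@le_lt_trans _ _ (mu (box L))).
  by apply: le_measure; rewrite ?inE//; [exact: measurable_cube|exact: sub_box].
by rewrite [X in (X < _)%E]measure_box ?ltry.
Qed.

(** The cyclic shift of the torus is the translation by one mesh, except across
    the boundary of the box, where both points are outside Omega and phi is 0. *)
Lemma grid_shift (phi : 'rV[R]_d -> R) M (n : {ffun 'I_d -> 'I_(M.*2.+1)}) i :
  (forall x, ~ Omega x -> phi x = 0) ->
  phi (grid L (n + torus_shift i)) = phi (grid L n + h M *: e_ i).
Proof.
move=> phi0.
have hN : h M * M.*2.+1%:R = L by rewrite /mesh divfK.
have := ltn_ord (n i); rewrite leq_eqVlt => /predU1P[ni|ni]; last first.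
  congr phi; apply/rowP => j; rewrite !mxE/= !ffunE.
  have [->|ji] := eqVneq j i.
    rewrite /= modnDmr addn1 modn_small// -natr1; ring.
  by rewrite addr0 ?andbF mulr0 addr0.
have hn : h M * (n i)%:R = L - h M.
  have E : M.*2.+1%:R = (n i)%:R + 1 :> R by rewrite natr1 ni.
  by move: hN; rewrite E mulrDr mulr1; lra.
rewrite !phi0// => /Omega_box/(_ i); rewrite !mxE/= ?ffunE eqxx/=.
  by rewrite hn mulr1; lra.
by rewrite modnDmr addn1 ni modnn mulr0; lra.
Qed.

(** For a fine mesh the cell of a grid point in K lies in Omega. *)
Lemma support_count (K : set 'rV[R]_d) : compact K -> K `<=` Omega ->
  \forall M \near \oo, h M ^+ d *
    #|[pred n : {ffun 'I_d -> 'I_(M.*2.+1)} | `[< K (grid L n) >]]|%:R <=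
    fine (mu Omega).
Proof.
move=> cK KO.
have [e e0 eO] := near_right_ex (compact_ball_subset cK Omega_open KO).
near=> M.
have he : h M < e by near: M; exact: near_mesh.
have h0 := mesh_gt0 L_gt0 M.
have mO := open_measurable_rV Omega_open.
rewrite -lee_fin fineK; last by rewrite ge0_fin_numE// sub_box_measure_fin.
rewrite -sum1_card natr_sum big_mkcond/= -[leRHS]mul1e -integral_cst//.
apply: (lattice_sum_le (a := - (L / 2))) => //.
- by move=> n; case: ifP.
- move=> n; case: ifPn => [/asboolP Kn _|]; last by rewrite eqxx.
  move=> v nv; apply: (eO _ Kn); split => // i j; rewrite (ord1 i).
  have := nv j; rewrite !mxE in_itv/= => /andP[v1 v2].
  by rewrite /ball/= ltr_distlC; apply/andP; split; rewrite ?mxE; lra.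
- by move=> n v _ _; case: ifP.
Unshelve. all: end_near. Qed.

End test_functions.

(** * Convergence of the sampled Gram matrix and Dirichlet energy *)

Section sampled_limits.
Context {R : realType} {d : nat}.
Local Notation mu := (@lebesgue_rV R d).
Local Notation e_ i := (delta_mx 0 i : 'rV[R]_d).

Lemma quad_form_le (J : finType) (G : J -> J -> R) (e : R) (c : J -> R) :
  (forall j l, `|G j l - (j == l)%:R| <= e) ->
  \sum_j \sum_l c j * c l * G j l <= (1 + e * #|J|%:R) * \sum_j c j ^+ 2.
Proof.
move=> Ge.
have -> : (1 + e * #|J|%:R) * \sum_j c j ^+ 2 = \sum_j \sum_l
    (c j * c l * (j == l)%:R + e * ((c j ^+ 2 + c l ^+ 2) / 2)).
  transitivity (\sum_j (c j ^+ 2 + e * (#|J|%:R * c j ^+ 2 / 2 +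
       (\sum_l c l ^+ 2) / 2))).
    rewrite big_split/= -mulr_sumr big_split/= -mulr_suml -mulr_sumr.
    by rewrite sumr_const -mulr_natl; field.
  apply: eq_bigr => j _; rewrite big_split/=.
  rewrite [X in _ = X + _](bigD1 j)//= eqxx mulr1 -expr2.
  rewrite [X in _ = _ + X + _]big1 ?addr0; last first.
    by move=> l lj; rewrite eq_sym (negbTE lj) mulr0.
  congr (_ + _); rewrite -mulr_sumr; congr (_ * _).
  rewrite -mulr_suml big_split/= sumr_const mulrDl mulr_natl.
  by congr (_ *+ _ / 2 + _); exact: eq_card.
apply: ler_sum => j _; apply: ler_sum => l _.
have cc : `|c j * c l| <= (c j ^+ 2 + c l ^+ 2) / 2.
  rewrite ler_norml; apply/andP; split.
    have := sqr_ge0 (c j + c l); rewrite sqrrD; lra.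
  have := sqr_ge0 (c j - c l); rewrite sqrrB; lra.
rewrite -lerBlDl -mulrBr (le_trans (ler_norm _))// normrM mulrC.
by apply: ler_pM.
Qed.

Variables (Omega : set 'rV[R]_d).
Hypotheses (Omega_open : open Omega).

Lemma near_gram (L eps : R) (f g : 'rV[R]_d -> R) : 0 < L -> 0 < eps ->
  (forall v, Omega v -> forall i, - (L / 2) < v 0 i < L / 2) ->
  test_function Omega f -> test_function Omega g ->
  \forall M \near \oo,
    `|mesh L M ^+ d * (\sum_(n : {ffun 'I_d -> 'I_(M.*2.+1)})
         f (grid L n) * g (grid L n)) -
     \int[mu]_(x in Omega) (f x * g x)| <= eps.
Proof.
move=> L0 eps0 Ob tf tg.
have cf := test_function_continuous tf; have cg := test_function_continuous tg.
have cK := test_function_compact tf.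
have mO := open_measurable_rV Omega_open.
have Obox := sub_box Ob.
have f0 := @test_function_eq0 _ _ f.
have cfg : continuous (fun x => f x * g x).
  by move=> x; apply: continuousM; [exact: cf|exact: cg].
have cfgN : continuous (fun x => - (f x * g x)).
  move=> x; apply: (@continuous_comp _ _ _ (fun x => f x * g x) -%R).
    exact: cfg.
  exact: opp_continuous.
have fg0 x : ~ closure [set x | f x != 0] x -> f x * g x = 0.
  by move=> /f0 ->; rewrite mul0r.
have fg0N x : ~ closure [set x | f x != 0] x -> - (f x * g x) = 0.
  by move=> /fg0 ->; rewrite oppr0.
have ifg : mu.-integrable Omega (EFin \o (fun x => f x * g x)).
  by apply: (compact_support_integrable cK) => //; exact: sub_box_measure_fin Ob.
have up := riemann_sum_le L0 cK cfg fg0 mO (test_function_sub tf) Obox eps0.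
have lo := riemann_sum_le L0 cK cfgN fg0N mO (test_function_sub tf) Obox eps0.
near=> M.
have bc (n : {ffun 'I_d -> 'I_(M.*2.+1)}) : ball (grid L n) (mesh L M * 2) (grid L n).
  by apply: ballxx; rewrite mulr_gt0// mesh_gt0.
have Hup : forall y : {ffun 'I_d -> 'I_(M.*2.+1)} -> 'rV[R]_d,
    (forall n, ball (grid L n) (mesh L M * 2) (y n)) ->
    mesh L M ^+ d * \sum_n f (y n) * g (y n) <=
    \int[mu]_(x in Omega) (f x * g x) + eps by near: M.
have Hlo : forall y : {ffun 'I_d -> 'I_(M.*2.+1)} -> 'rV[R]_d,
    (forall n, ball (grid L n) (mesh L M * 2) (y n)) ->
    mesh L M ^+ d * \sum_n - (f (y n) * g (y n)) <=
    \int[mu]_(x in Omega) (- (f x * g x)) + eps by near: M.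
rewrite ler_norml; apply/andP; split; last by rewrite lerBlDl; exact: Hup.
have := Hlo _ bc.
have -> : \int[mu]_(x in Omega) (- (f x * g x)) = - \int[mu]_(x in Omega) (f x * g x).
  under eq_Rintegral do rewrite -mulN1r.
  by rewrite RintegralZl// mulN1r.
by rewrite sumrN mulrN; lra.
Unshelve. all: end_near. Qed.

Lemma near_energy (L eps : R) (f : 'rV[R]_d -> R) (i : 'I_d) : 0 < L -> 0 < eps ->
  (forall v, Omega v -> forall i, - (L / 2) < v 0 i < L / 2) ->
  test_function Omega f ->
  \forall M \near \oo,
    mesh L M ^+ d * (\sum_(n : {ffun 'I_d -> 'I_(M.*2.+1)})
       ((f (grid L (n + torus_shift i)) - f (grid L n)) / mesh L M) ^+ 2) <=
     \int[mu]_(x in Omega) (partial i f x ^+ 2) + eps.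
Proof.
move=> L0 eps0 Ob tf.
have cf := @partial_continuous _ _ _ _ tf i.
have cK := test_function_compact tf.
have mO := open_measurable_rV Omega_open.
have Obox := sub_box Ob.
have cg : continuous (fun x => partial i f x ^+ 2).
  by move=> x; apply: continuousM; exact: cf.
have g0 x : ~ closure [set x | f x != 0] x -> partial i f x ^+ 2 = 0.
  by move=> /(@partial_eq0 _ _ f i) ->; rewrite expr0n.
have up := riemann_sum_le L0 cK cg g0 mO (test_function_sub tf) Obox eps0.
near=> M.
have h0 := mesh_gt0 L0 M.
have Hup : forall y : {ffun 'I_d -> 'I_(M.*2.+1)} -> 'rV[R]_d,
    (forall n, ball (grid L n) (mesh L M * 2) (y n)) ->
    mesh L M ^+ d * \sum_n partial i f (y n) ^+ 2 <=
    \int[mu]_(x in Omega) partial i f x ^+ 2 + eps by near: M.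
have mv (n : {ffun 'I_d -> 'I_(M.*2.+1)}) : exists s : R, 0 <= s <= mesh L M /\
    f (grid L (n + torus_shift i)) - f (grid L n) =
    mesh L M * partial i f (grid L n + s *: e_ i).
  have [s sh E] := partial_mean_value tf i (grid L n) h0.
  exists s; split=> //; rewrite (grid_shift Ob)//.
  exact: test_function_eq0_out.
(* The difference quotients are values of the derivative at tags y_n within
   one mesh of the grid points. *)
have /choice[s sP] := mv.
have quotE (n : {ffun 'I_d -> 'I_(M.*2.+1)}) :
    (f (grid L (n + torus_shift i)) - f (grid L n)) / mesh L M =
    partial i f (grid L n + s n *: e_ i).
  by rewrite (sP n).2 mulrC mulKf// gt_eqF.
under eq_bigr do rewrite quotE.
apply: (Hup (fun n => grid L n + s n *: e_ i)) => n.
split; first by rewrite mulr_gt0.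
move=> a j; rewrite (ord1 a) /ball/= ltr_distlC !mxE eqxx/=.
have [/andP[s0 sh] _] := sP n.
by case: (j == i); rewrite ?mulr1 ?mulr0; apply/andP; split; lra.
Unshelve. all: end_near. Qed.

End sampled_limits.

(** * The Berezin-Li-Yau inequality for almost orthonormal test functions *)

Section approximate_berezin.
Context {R : realType} {d : nat}.
Local Notation mu := (@lebesgue_rV R d).

(** An infinite volume would make the left-hand side of riesz_volume_Gamma 0 or
    infinite. *)
Lemma riesz_volume_fin_num : @riesz_volume R d \is a fin_num.
Proof.
have V0 : (0 <= @riesz_volume R d)%E.
  by apply: integral_ge0 => v _; rewrite lee_fin le_max lexx.
rewrite ge0_fin_numE// ltey; apply/eqP => Voo.
have := @riesz_volume_Gamma R d; rewrite Voo.
set I := integral _ _ _ => E.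
have I0 : (0 <= I)%E.
  by apply: integral_ge0 => t _; rewrite lee_fin mulr_ge0 ?powR_ge0 ?expR_ge0.
have [I00|I00] := eqVneq I 0%E.
  move: E; rewrite I00 mule0 => /esym/eqP; rewrite eqe => /eqP E.
  have : 0 < Num.sqrt pi ^+ d :> R by rewrite exprn_gt0// sqrtr_gt0 pi_gt0.
  by rewrite E ltxx.
by move: E; rewrite gt0_mulye// lt_neqAle eq_sym I00.
Qed.

Variables (Omega : set 'rV[R]_d).
Hypotheses (Omega_open : open Omega).

(** The bound of freq_sum_le for c = 1 - eta and w = eta, so that a single
    parameter eta controls all the errors; it tends to z * z^(d/2). *)
Definition phase_volume (z eta : R) : R :=
  (z + (1 - eta) * d%:R * eta) *
  ((z + (1 - eta) * d%:R * eta) / ((1 - eta) / (1 + eta))) `^ (d%:R / 2).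

(** The box has side L = 2 pi / eta, which makes the frequency mesh 2 pi / L
    equal to eta.  Only the mesh of the grid depends on M, and one M large enough
    is chosen. *)
Lemma test_function_berezin_approx (J : finType) (phi : J -> 'rV[R]_d -> R)
    (z eps eta : R) : 0 < z -> 0 <= eps -> 0 < eta < 1 ->
  (forall v, Omega v -> forall i, - (2 * pi / eta / 2) < v 0 i < 2 * pi / eta / 2) ->
  (forall j, test_function Omega (phi j)) ->
  (forall j l, `|\int[mu]_(x in Omega) (phi j x * phi l x) - (j == l)%:R| <= eps) ->
  \sum_j (z * (\int[mu]_(x in Omega) (phi j x * phi j x)) -
          \sum_i \int[mu]_(x in Omega) (partial i (phi j) x ^+ 2)) -
  #|J|%:R * (eta * (z + d%:R)) <=
  (1 + (eps + eta) * #|J|%:R) * fine (mu Omega) *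
    ((2 * pi) ^- d * (phase_volume z eta * fine (@riesz_volume R d))).
Proof.
move=> z0 eps0 /andP[eta0 eta1]; set L := 2 * pi / eta => Ob tphi gram.
have L0 : 0 < L by rewrite divr_gt0 ?mulr_gt0 ?pi_gt0.
pose K := \bigcup_(j in [set: J]) closure [set x | phi j x != 0].
have cK : compact K.
  rewrite /K (_ : [set: J] = [set` index_enum J]); last first.
    by apply/seteqP; split => // j _; rewrite /= mem_index_enum.
  rewrite bigcup_seq; apply: bigsetU_compact => j _.
  exact: test_function_compact (tphi j).
have KO : K `<=` Omega by move=> x [j _ /(test_function_sub (tphi j))].
have S1 := filter_forall _ (fun j => filter_forall _ (fun l =>
  near_gram Omega_open L0 eta0 Ob (tphi j) (tphi l))).
have S2 := filter_forall _ (fun j => filter_forall _ (fun i =>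
  near_energy Omega_open i L0 eta0 Ob (tphi j))).
have S3 := support_count Omega_open L0 Ob cK KO.
have S4 : \forall M \near \oo, z * mesh L M ^+ 2 <= 2 * (1 - (1 - eta)).
  near=> M.
  have h0 := mesh_gt0 L0 M.
  have h1 : mesh L M < 1 by near: M; exact: near_mesh.
  have h2 : mesh L M < 2 * eta / z.
    by near: M; apply: near_mesh; rewrite ?divr_gt0 ?mulr_gt0.
  rewrite opprB addrC subrK; move: h2; rewrite ltr_pdivlMr// => h2.
  by nra.
have [M [S1M [S2M [S3M S4M]]]] := filter_ex (filterI (S1 _ _) (filterI (S2 _ _) (filterI S3 S4))).
have h0 := mesh_gt0 L0 M.
set h := mesh L M in S1M S2M S3M S4M h0.
pose N := M.*2.+1.
pose g j (n : {ffun 'I_d -> 'I_N}) := phi j (grid L n).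
pose A := finset (fun n : {ffun 'I_d -> 'I_N} => `[< K (grid L n) >]).
have hd0 : 0 < h ^+ d by rewrite exprn_gt0.
pose B := 1 + (eps + eta) * #|J|%:R.
have B0 : 0 < B by rewrite ltr_wpDr// mulr_ge0// addr_ge0// ltW.
have := @discrete_berezin R d M.*2 M J g A (B / h ^+ d) z h.
have gA j n : n \notin A -> g j n = 0.
  rewrite inE => /asboolPn KN; apply: test_function_eq0 => Kn; apply: KN.
  by exists j.
have gB (c : J -> R) : \sum_n (\sum_j c j * g j n) ^+ 2 <=
    B / h ^+ d * \sum_j c j ^+ 2.
  rewrite mulrAC ler_pdivlMr// mulrC.
  have -> : h ^+ d * \sum_n (\sum_j c j * g j n) ^+ 2 =
      \sum_j \sum_l c j * c l * (h ^+ d * \sum_n g j n * g l n).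
    under eq_bigr do rewrite expr2 mulr_suml.
    rewrite exchange_big/= mulr_sumr; apply: eq_bigr => j _.
    under eq_bigr do rewrite mulr_sumr.
    rewrite exchange_big/= mulr_sumr; apply: eq_bigr => l _.
    rewrite !mulr_sumr; apply: eq_bigr => n _; ring.
  apply: quad_form_le => j l.
  rewrite (_ : _ - _ = (h ^+ d * \sum_n g j n * g l n -
     \int[mu]_(x in Omega) (phi j x * phi l x)) +
     (\int[mu]_(x in Omega) (phi j x * phi l x) - (j == l)%:R)); last by ring.
  by apply: (le_trans (ler_normD _ _)); rewrite addrC lerD//; exact: S1M.
move=> /(_ (divr_gt0 B0 hd0) h0 gA gB).
set S := \sum_k _ => berezin.
(* The box side is N h = 2 pi / eta, so eta is the frequency mesh. *)
have wE : eta = 2 * pi / (N%:R * h).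
  have -> : N%:R * h = L by rewrite mulrC /h /mesh divfK// pnatr_eq0.
  rewrite /L; have := pi_gt0 R; move: (pi : R) => p p0; field.
  by rewrite !gt_eqF.
have c0 : 0 < 1 - eta by rewrite subr_gt0.
have := @freq_sum_le R d M (1 - eta) z h eta c0 z0 h0 S4M wE.
rewrite -/S -/(phase_volume z eta) -(fineK riesz_volume_fin_num) -EFinM lee_fin => Sle.
apply: (@le_trans _ _ (h ^+ d * \sum_j (z * (\sum_n g j n ^+ 2) -
   \sum_i \sum_(n : {ffun 'I_d -> 'I_N}) ((g j (n + torus_shift i) - g j n) / h) ^+ 2))).
  rewrite mulr_sumr lerBlDl.
  have -> : #|J|%:R * (eta * (z + d%:R)) = \sum_(j : J) (eta * (z + d%:R)).
    by rewrite sumr_const mulr_natl; congr (_ *+ _); exact: eq_card.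
  rewrite -big_split/=; apply: ler_sum => j _.
  rewrite mulrBr mulrCA.
  have gr := S1M j j; rewrite ler_distlC in gr; move: gr => /andP[gr1 gr2].
  have E1 : \sum_n g j n ^+ 2 =
      \sum_(n : {ffun 'I_d -> 'I_N}) phi j (grid L n) * phi j (grid L n).
    by apply: eq_bigr => n _; rewrite expr2.
  have E2 : h ^+ d * (\sum_i \sum_(n : {ffun 'I_d -> 'I_N})
      ((g j (n + torus_shift i) - g j n) / h) ^+ 2) <=
      \sum_i \int[mu]_(x in Omega) partial i (phi j) x ^+ 2 + d%:R * eta.
    have -> : d%:R * eta = \sum_(i < d) eta by rewrite sumr_const card_ord mulr_natl.
    by rewrite mulr_sumr -big_split/=; apply: ler_sum => i _; exact: S2M.
  rewrite E1.
  have : z * (\int[mu]_(x in Omega) (phi j x * phi j x)) <=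
     z * (h ^+ d * (\sum_(n : {ffun 'I_d -> 'I_N})
       phi j (grid L n) * phi j (grid L n)) + eta).
    by rewrite ler_pM2l//; move: gr1 gr2; rewrite -/h; lra.
  by lra.
apply: (@le_trans _ _ (h ^+ d * (B / h ^+ d * #|A|%:R * ((N ^ d)%:R^-1 * S)))).
  by rewrite ler_pM2l.
have S0 : 0 <= S by apply: sumr_ge0 => k _; rewrite le_max lexx.
have NE : (N ^ d)%:R^-1 * S = h ^+ d * ((2 * pi) ^- d * (eta ^+ d * S)).
  have N0 : N%:R != 0 :> R by rewrite pnatr_eq0.
  have Ninv : N%:R^-1 = h * (2 * pi)^-1 * eta.
    rewrite {1}wE; have := pi_gt0 R; move: (pi : R) (N%:R) N0 => p n n0 p0; field.
    by rewrite n0 !gt_eqF.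
  by rewrite natrX -!exprVn Ninv !exprMn !mulrA.
rewrite NE.
have -> : h ^+ d * (B / h ^+ d * #|A|%:R * (h ^+ d * ((2 * pi) ^- d * (eta ^+ d * S)))) =
   B * (h ^+ d * #|A|%:R) * ((2 * pi) ^- d * (eta ^+ d * S)).
  by move: (h ^+ d) hd0 ((2 * pi) ^- d) => hd hd0 P; field; rewrite gt_eqF.
have Av : h ^+ d * #|A|%:R <= fine (mu Omega).
  by rewrite (_ : #|A| = #|[pred n : {ffun 'I_d -> 'I_N} | `[< K (grid L n) >]]|)// cardsE.
have p0 : 0 < (2 * pi) ^- d :> R by rewrite invr_gt0 exprn_gt0// mulr_gt0 ?pi_gt0.
apply: ler_pM.
- by rewrite mulr_ge0 ?mulr_ge0// ltW.
- by rewrite mulr_ge0 ?mulr_ge0 ?exprn_ge0// ltW.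
- by rewrite ler_pM2l.
- by rewrite ler_pM2l.
Unshelve. all: end_near. Qed.

End approximate_berezin.

Section test_function_limit.
Context {R : realType} {d : nat}.
Local Notation mu := (@lebesgue_rV R d).

Lemma cvg_phase_volume (z : R) : 0 < z ->
  @phase_volume R d z eta @[eta --> (0:R)^'+] --> z * z `^ (d%:R / 2).
Proof.
move=> z0; pose u (eta : R) := z + (1 - eta) * d%:R * eta.
have cu : u eta @[eta --> (0:R)] --> z.
  rewrite [X in _ --> X](_ : z = u 0); last by rewrite /u mulr0 addr0.
  apply: (@cvgD _ R^o); first exact: cvg_cst.
  apply: (@cvgM R R); last exact: cvg_id.
  apply: (@cvgM R R); last exact: cvg_cst.
  by apply: (@cvgB _ R^o); [exact: cvg_cst|exact: cvg_id].
have cv : (u eta / ((1 - eta) / (1 + eta))) @[eta --> (0:R)] --> z.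
  rewrite [X in _ --> X](_ : z = z / ((1 - 0) / (1 + 0))); last first.
    by rewrite subr0 addr0 !divr1.
  apply: (@cvgM R R) => //; apply: cvgV.
    by rewrite subr0 addr0 divr1 oner_neq0.
  apply: (@cvgM R R).
    by apply: (@cvgB _ R^o); [exact: cvg_cst|exact: cvg_id].
  apply: cvgV; first by rewrite addr0 oner_neq0.
  by apply: (@cvgD _ R^o); [exact: cvg_cst|exact: cvg_id].
have cp : {for z, continuous (fun y : R => y `^ (d%:R / 2))}.
  apply: differentiable_continuous; apply/derivable1_diffP.
  by apply: derivable_powR; rewrite in_itv/= z0.
apply: cvg_at_right_filter; apply: (@cvgM R R); first exact: cu.
exact: (cvg_comp _ _ cv cp).
Qed.

Variables (Omega : set 'rV[R]_d).
Hypotheses (Omega_open : open Omega) (Omega_bounded : bounded_set Omega).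

Lemma bounded_set_coord : exists2 C : R, 0 < C &
  forall v, Omega v -> forall i, `|v 0 i| < C.
Proof.
have [C [_ /(_ (`|C| + 1)) Cb]] := Omega_bounded.
have C1 : C < `|C| + 1 by rewrite (le_lt_trans (ler_norm _))// ltrDl.
exists (`|C| + 2) => [|v Ov i]; first by rewrite ltr_wpDl.
have vC : `|v| < `|C| + 2.
  by apply: (le_lt_trans (Cb C1 v Ov)); rewrite ltrD2l ltr1n.
have [_ /(_ 0 i)] : ball (0 : 'rV[R]_d) (`|C| + 2) v.
  by rewrite mx_norm_ball /ball_/= sub0r normrN.
rewrite -ball_normE /ball_/=. by rewrite mxE sub0r normrN.
Qed.

(** Passage to the limit eta -> 0, that is, to large boxes, in
    test_function_berezin_approx. *)
Lemma test_function_berezin (J : finType) (phi : J -> 'rV[R]_d -> R)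
    (z eps : R) : 0 < z -> 0 <= eps ->
  (forall j, test_function Omega (phi j)) ->
  (forall j l, `|\int[mu]_(x in Omega) (phi j x * phi l x) - (j == l)%:R| <= eps) ->
  \sum_j (z * (\int[mu]_(x in Omega) (phi j x * phi j x)) -
          \sum_i \int[mu]_(x in Omega) (partial i (phi j) x ^+ 2)) <=
  (1 + eps * #|J|%:R) * fine (mu Omega) *
    ((2 * pi) ^- d * ((z * z `^ (d%:R / 2)) * fine (@riesz_volume R d))).
Proof.
move=> z0 eps0 tphi gram.
set lhs := \sum_j _.
have [C C0 Cb] := bounded_set_coord.
have cid : (eta : R) @[eta --> (0:R)^'+] --> (0 : R).
  by apply: cvg_at_right_filter; exact: cvg_id.
have cL : (lhs - #|J|%:R * (eta * (z + d%:R))) @[eta --> (0:R)^'+] --> lhs.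
  rewrite [X in _ --> X](_ : lhs = lhs - #|J|%:R * (0 * (z + d%:R))); last first.
    by rewrite mul0r mulr0 subr0.
  apply: (@cvgB _ R^o); first exact: cvg_cst.
  apply: (@cvgM R R); first exact: cvg_cst.
  by apply: (@cvgM R R) => //; exact: cvg_cst.
have cR : ((1 + (eps + eta) * #|J|%:R) * fine (mu Omega) *
    ((2 * pi) ^- d * (@phase_volume R d z eta * fine (@riesz_volume R d))))
    @[eta --> (0:R)^'+] --> (1 + eps * #|J|%:R) * fine (mu Omega) *
    ((2 * pi) ^- d * ((z * z `^ (d%:R / 2)) * fine (@riesz_volume R d))).
  apply: (@cvgM R R).
    apply: (@cvgM R R); last exact: cvg_cst.
    apply: (@cvgD _ R^o); first exact: cvg_cst.
    apply: (@cvgM R R); last exact: cvg_cst.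
    rewrite -[X in _ --> X]addr0.
    by apply: (@cvgD _ R^o) => //; exact: cvg_cst.
  apply: (@cvgM R R); first exact: cvg_cst.
  by apply: (@cvgM R R); [exact: cvg_phase_volume|exact: cvg_cst].
apply: (ler_cvg_to cL cR); near=> eta.
have eta0 : 0 < eta by near: eta; exact: nbhs_right_gt.
have eta1 : eta < 1 by near: eta; apply: nbhs_right_lt.
have etaC : eta < pi / C by near: eta; apply: nbhs_right_lt; rewrite divr_gt0 ?pi_gt0.
apply: test_function_berezin_approx => //; first by rewrite eta0.
move=> v /Cb vC i; rewrite -ltr_norml; apply: (lt_trans (vC i)).
rewrite mulrAC (mulrAC 2) divff// mul1r ltr_pdivlMr//.
by move: etaC; rewrite ltr_pdivlMr// mulrC.
Unshelve. all: end_near. Qed.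

End test_function_limit.

(** * Square integrable functions *)

Section square_integrable.
Context {disp : measure_display} {T : measurableType disp} {R : realType}.
Variables (mu : {measure set T -> \bar R}) (D : set T).
Hypothesis mD : measurable D.
Implicit Types f g : T -> R.

Definition L2 f := measurable_fun D f /\ (\int[mu]_(x in D) (f x ^+ 2)%:E < +oo)%E.

Definition ip f g : R := \int[mu]_(x in D) (f x * g x).

Lemma L2_integrable_sqr f : L2 f -> mu.-integrable D (EFin \o (fun x => f x ^+ 2)).
Proof.
move=> [mf foo]; apply/integrableP; split.
  by apply/measurable_EFinP; exact: measurable_funX.
apply: le_lt_trans foo; apply: ge0_le_integral => //=.
- by apply/measurable_EFinP; apply: measurableT_comp => //; exact: measurable_funX.
- by apply/measurable_EFinP; exact: measurable_funX.
- by move=> x _; rewrite lee_fin ger0_norm ?sqr_ge0.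
Qed.

Lemma L2_integrableM f g : L2 f -> L2 g ->
  mu.-integrable D (EFin \o (fun x => f x * g x)).
Proof.
move=> Lf Lg; have [mf _] := Lf; have [mg _] := Lg.
have := integrableD mD (L2_integrable_sqr Lf) (L2_integrable_sqr Lg).
apply: le_integrable => //.
  by apply/measurable_EFinP; exact: measurable_funM.
move=> x _ /=; rewrite lee_fin [leRHS]ger0_norm ?addr_ge0 ?sqr_ge0//.
move: (f x) (g x) => a b; rewrite ler_norml.
have := sqr_ge0 (a + b); have := sqr_ge0 (a - b).
by have := sqr_ge0 a; have := sqr_ge0 b; move=> *; apply/andP; split; nra.
Qed.

Lemma L2_of_integrable_sqr f : measurable_fun D f ->
  mu.-integrable D (EFin \o (fun x => f x ^+ 2)) -> L2 f.
Proof.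
move=> mf /integrableP[_ foo]; split=> //.
apply: le_lt_trans foo; apply: ge0_le_integral => //=.
- by move=> x _; rewrite lee_fin sqr_ge0.
- by apply/measurable_EFinP; exact: measurable_funX.
- by apply/measurable_EFinP; apply: measurableT_comp => //; exact: measurable_funX.
- by move=> x _; rewrite lee_fin ler_norm.
Qed.

Lemma L2_lin (a b : R) f g : L2 f -> L2 g -> L2 (fun x => a * f x + b * g x).
Proof.
move=> Lf Lg; have [mf _] := Lf; have [mg _] := Lg.
have mfg : measurable_fun D (fun x => a * f x + b * g x).
  by apply: measurable_funD; apply: measurable_funM => //.
apply: L2_of_integrable_sqr => //.
have i1 := integrableZl mD (2 * a ^+ 2) (L2_integrable_sqr Lf).
have i2 := integrableZl mD (2 * b ^+ 2) (L2_integrable_sqr Lg).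
have := integrableD mD i1 i2; apply: le_integrable => //.
  by apply/measurable_EFinP; exact: measurable_funX.
move=> x _ /=; rewrite lee_fin !ger0_norm ?sqr_ge0//; last first.
  by apply: addr_ge0; rewrite -mulrA mulr_ge0// mulr_ge0// sqr_ge0.
by have := sqr_ge0 (a * f x - b * g x); lra.
Qed.

Lemma L2_0 : L2 (cst 0).
Proof.
split; first exact: measurable_cst.
rewrite integral0_eq ?ltry// => x _; by rewrite expr0n.
Qed.

Lemma L2_ext f g : f =1 g -> L2 f -> L2 g.
Proof. by move=> /funext ->. Qed.

Lemma L2B f g : L2 f -> L2 g -> L2 (fun x => f x - g x).
Proof.
move=> Lf Lg; apply: L2_ext (L2_lin 1 (-1) Lf Lg) => x.
by rewrite mul1r mulN1r.
Qed.

Lemma L2_sum (I : Type) (r : seq I) (c : I -> R) (f : I -> T -> R) :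
  (forall i, L2 (f i)) -> L2 (fun x => \sum_(i <- r) c i * f i x).
Proof.
move=> Lf; elim: r => [|i r IHr].
  by apply: L2_ext L2_0 => x; rewrite big_nil.
apply: L2_ext (L2_lin (c i) 1 (Lf i) IHr) => x.
by rewrite big_cons mul1r.
Qed.

Lemma ipC f g : ip f g = ip g f.
Proof. by apply: eq_Rintegral => x _; rewrite mulrC. Qed.

Lemma ip_linl (a b : R) f1 f2 g : L2 f1 -> L2 f2 -> L2 g ->
  ip (fun x => a * f1 x + b * f2 x) g = a * ip f1 g + b * ip f2 g.
Proof.
move=> L1 L2' Lg; rewrite /ip.
have i1 := L2_integrableM L1 Lg; have i2 := L2_integrableM L2' Lg.
rewrite -!RintegralZl// -RintegralD//.
- by apply: eq_Rintegral => x _; ring.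
- exact: (integrableZl mD a i1).
- exact: (integrableZl mD b i2).
Qed.

Lemma ip_lin_sqr (a b : R) f g : L2 f -> L2 g ->
  ip (fun x => a * f x + b * g x) (fun x => a * f x + b * g x) =
  a ^+ 2 * ip f f + 2 * a * b * ip f g + b ^+ 2 * ip g g.
Proof.
move=> Lf Lg; have Lfg := L2_lin a b Lf Lg.
rewrite ip_linl// [ip f _]ipC [ip g _]ipC !ip_linl// (ipC g f); ring.
Qed.

Lemma ip0l g : ip (cst 0) g = 0.
Proof.
rewrite /ip /Rintegral integral0_eq// => x _; by rewrite mul0r.
Qed.

Lemma ip_suml (I : Type) (r : seq I) (c : I -> R) (f : I -> T -> R) g :
  (forall i, L2 (f i)) -> L2 g ->
  ip (fun x => \sum_(i <- r) c i * f i x) g = \sum_(i <- r) c i * ip (f i) g.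
Proof.
move=> Lf Lg; elim: r => [|i r IHr].
  rewrite big_nil -[RHS](ip0l g); apply: eq_Rintegral => x _.
  by rewrite big_nil.
rewrite big_cons -IHr -[X in _ + X]mul1r -ip_linl//; last exact: L2_sum.
by apply: eq_Rintegral => x _; rewrite big_cons mul1r.
Qed.

Lemma ip_ge0 f : 0 <= ip f f.
Proof. by apply: Rintegral_ge0 => x _; rewrite -expr2 sqr_ge0. Qed.

(** Expand the squares of f / e - g and f / e + g.  With e free this replaces the
    Cauchy-Schwarz inequality. *)
Lemma ip_le (e : R) f g : 0 < e -> L2 f -> L2 g ->
  `|ip f g| <= e^-1 * ip f f + e * ip g g.
Proof.
move=> e0 Lf Lg; have ei0 : 0 < e^-1 by rewrite invr_gt0.
have := ip_ge0 (fun x => e^-1 * f x + 1 * g x).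
have := ip_ge0 (fun x => e^-1 * f x + (-1) * g x).
rewrite !ip_linl ?[ip _ (fun x => _ + _)]ipC ?ip_linl//; try exact: L2_lin.
rewrite (ipC g f) !mul1r.
have f0 := ip_ge0 f; have g0 := ip_ge0 g.
move: (ip f f) (ip g g) (ip f g) f0 g0 => a b c a0 b0 H1 H2.
have H1' : 0 <= e * (e^-1 * (e^-1 * a + -1 * c) + -1 * (e^-1 * c + -1 * b)).
  by rewrite mulr_ge0// ltW.
have H2' : 0 <= e * (e^-1 * (e^-1 * a + c) + (e^-1 * c + b)).
  by rewrite mulr_ge0// ltW.
have E1 : e * (e^-1 * (e^-1 * a + -1 * c) + -1 * (e^-1 * c + -1 * b)) =
   e^-1 * a - 2 * c + e * b by field; rewrite gt_eqF.
have E2 : e * (e^-1 * (e^-1 * a + c) + (e^-1 * c + b)) =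
   e^-1 * a + 2 * c + e * b by field; rewrite gt_eqF.
have ea : 0 <= e^-1 * a by rewrite mulr_ge0// ltW.
have eb : 0 <= e * b by rewrite mulr_ge0// ltW.
rewrite E1 in H1'; rewrite E2 in H2'.
by rewrite ler_norml; apply/andP; split; lra.
Qed.

Lemma ip_eq0_ae f : L2 f -> ip f f = 0 -> ae_eq mu D f (cst 0).
Proof.
move=> Lf; have [mf _] := Lf; rewrite /ip => f0.
have : (\int[mu]_(x in D) `|(f x ^+ 2)%:E| = 0)%E.
  have i2 := L2_integrable_sqr Lf.
  under eq_integral do rewrite gee0_abs ?lee_fin ?sqr_ge0//.
  rewrite -[LHS]fineK; last exact: integrable_fin_num.
  by congr EFin; rewrite -f0; apply: eq_Rintegral => x _; rewrite expr2.
move/ae_eq_integral_abs => H.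
have /H : measurable_fun D (fun x => (f x ^+ 2)%:E).
  by apply/measurable_EFinP; exact: measurable_funX.
move=> /(_ mD); apply: filterS => x /= xD Dx.
by have /eqP := xD Dx; rewrite eqe sqrf_eq0 => /eqP.
Qed.

Section convergence.
Variables (f g : nat -> T -> R) (f0 g0 : T -> R).
Hypotheses (Lf : forall k, L2 (f k)) (Lg : forall k, L2 (g k)).
Hypotheses (Lf0 : L2 f0) (Lg0 : L2 g0).

Let cvg_ip0 (a : nat -> T -> R) h : (forall k, L2 (a k)) -> L2 h ->
  ip (a k) (a k) @[k --> \oo] --> (0 : R) -> ip (a k) h @[k --> \oo] --> (0 : R).
Proof.
move=> La Lh /cvgrPdist_le a0; apply/cvgrPdist_le => e e0.
(* This weight in ip_le makes the term in h at most e / 2. *)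
pose s := e / 2 / (ip h h + 1).
have h0 := ip_ge0 h.
have s0 : 0 < s by rewrite !divr_gt0// ltr_wpDl.
have se0 : 0 < s * (e / 2) by rewrite mulr_gt0// divr_gt0.
near=> k.
have : `|0 - ip (a k) (a k)| <= s * (e / 2) by near: k; exact: a0.
rewrite !sub0r !normrN ger0_norm ?ip_ge0// => ak.
apply: (le_trans (ip_le s0 (La k) Lh)).
rewrite [leRHS]splitr; apply: lerD; first by rewrite ler_pdivrMl.
rewrite /s mulrAC ler_pdivrMr ?ltr_wpDl// ler_pM2l ?divr_gt0//.
by rewrite lerDl.
Unshelve. all: end_near. Qed.

(** With a = f k - f0 and b = g k - g0, the difference of the inner products is
    the sum of those of (a, b), (a, g0) and (b, f0), and each of them tends to 0. *)
Lemma ip_cvg :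
  ip (fun x => f k x - f0 x) (fun x => f k x - f0 x) @[k --> \oo] --> (0 : R) ->
  ip (fun x => g k x - g0 x) (fun x => g k x - g0 x) @[k --> \oo] --> (0 : R) ->
  ip (f k) (g k) @[k --> \oo] --> ip f0 g0.
Proof.
move=> cf cg.
pose a k x := f k x - f0 x; pose b k x := g k x - g0 x.
have La k : L2 (a k) by exact: L2B.
have Lb k : L2 (b k) by exact: L2B.
have E k : ip (f k) (g k) = ip (a k) (b k) + ip (a k) g0 + ip (b k) f0 + ip f0 g0.
  rewrite (_ : f k = fun x => 1 * a k x + 1 * f0 x); last first.
    by apply/funext => x; rewrite /a; ring.
  rewrite (_ : g k = fun x => 1 * b k x + 1 * g0 x); last first.
    by apply/funext => x; rewrite /b; ring.
  rewrite ip_linl//; last exact: L2_lin.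
  rewrite !(ipC _ (fun x => 1 * b k x + 1 * g0 x)) !ip_linl//.
  by rewrite (ipC (b k) (a k)) (ipC g0 (a k)) (ipC g0 f0); ring.
have cab : (ip (a k) (a k) + ip (b k) (b k)) @[k --> \oo] --> (0 : R).
  by rewrite -[X in _ --> X]addr0; apply: cvgD.
have cabN : - (ip (a k) (a k) + ip (b k) (b k)) @[k --> \oo] --> (0 : R).
  by rewrite -[X in _ --> X]oppr0; apply: cvgN.
(* The square of each of a and b is small, hence so is their product. *)
have ab0 : ip (a k) (b k) @[k --> \oo] --> (0 : R).
  apply: squeeze_cvgr cabN cab; near=> k.
  by have := ip_le ltr01 (La k) (Lb k); rewrite invr1 !mul1r ler_norml.
have ag0 := cvg_ip0 La Lg0 cf; have bf0 := cvg_ip0 Lb Lf0 cg.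
have C := cvgD (cvgD (cvgD ab0 ag0) bf0) (cvg_cst (ip f0 g0)).
rewrite !add0r in C.
rewrite (_ : (fun k => ip (f k) (g k)) = (fun k =>
  ip (a k) (b k) + ip (a k) g0 + ip (b k) f0 + ip f0 g0)); first exact: C.
exact/funext/E.
Unshelve. all: end_near. Qed.

End convergence.
End square_integrable.

(** * Eigenspaces of the Dirichlet Laplacian *)

Section linear_combination.
Context {R : realType} {V : normedModType R}.
Lemma fun_linE (f g : V -> R) (a b : R) :
  (fun x => a * f x + b * g x) = a *: f + b *: g.
Proof. by apply/funext => x. Qed.

Lemma is_derive_lin (f g : V -> R) (a b : R) (x v : V) :
  derivable f x v -> derivable g x v ->
  is_derive x v (fun x => a * f x + b * g x) (a * 'D_v f x + b * 'D_v g x).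
Proof.
move=> /derivableP df /derivableP dg; rewrite fun_linE.
exact: (is_deriveD (is_deriveZ a df) (is_deriveZ b dg)).
Qed.

Lemma continuous_lin (f g : V -> R) (a b : R) : continuous f -> continuous g ->
  continuous (fun x => a * f x + b * g x).
Proof.
move=> cf cg x; apply: cvgD; apply: cvgMr; [exact: cf|exact: cg].
Qed.
End linear_combination.

Lemma cvgn_sum {R : realType} (I : Type) (r : seq I) (f : I -> nat -> R) (l : I -> R) :
  (forall i, f i k @[k --> \oo] --> l i) ->
  (\sum_(i <- r) f i k) @[k --> \oo] --> \sum_(i <- r) l i.
Proof.
move=> fl; elim: r => [|i r IHr].
  by rewrite big_nil; under eq_fun do rewrite big_nil; exact: cvg_cst.
rewrite big_cons; under eq_fun do rewrite big_cons.
by apply: cvgD.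
Qed.

Section eigenspaces.
Context {R : realType} {d : nat}.
Local Notation mu := (@lebesgue_rV R d).
Variables (Omega : set 'rV[R]_d).
Hypotheses (Omega_open : open Omega) (Omega_bounded : bounded_set Omega).
Local Notation L2 := (L2 mu Omega).
Local Notation ip := (ip mu Omega).

Let mO : measurable Omega.
Proof. exact: open_measurable_rV. Qed.

Lemma bounded_measure_fin : (mu Omega < +oo)%E.
Proof.
have [C C0 Cb] := bounded_set_coord Omega_bounded.
apply: (@sub_box_measure_fin _ _ _ Omega_open (C *+ 2)); first by rewrite pmulrn_lgt0.
move=> v /Cb vC i.
by rewrite -[C *+ 2]mulr_natr mulfK// -ltr_norml.
Qed.

Lemma continuous_L2 (K : set 'rV[R]_d) (g : 'rV[R]_d -> R) :
  compact K -> continuous g -> (forall x, ~ K x -> g x = 0) -> L2 g.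
Proof.
move=> cK cg g0; apply: L2_of_integrable_sqr => //.
  by apply: measurable_funTS; exact: continuous_measurable_rV.
apply: (compact_support_integrable cK) => //.
- by move=> x; apply: continuousM; exact: cg.
- by move=> x /g0 ->; rewrite expr0n.
- exact: bounded_measure_fin.
Qed.

Lemma test_function_L2 phi : test_function Omega phi -> L2 phi.
Proof.
move=> tphi; apply: (continuous_L2 (test_function_compact tphi)).
  exact: (@test_function_continuous _ _ _ _ tphi).
exact: test_function_eq0.
Qed.

Lemma partial_L2 phi i : test_function Omega phi -> L2 (partial i phi).
Proof.
move=> tphi; apply: (continuous_L2 (test_function_compact tphi)).
  exact: (@partial_continuous _ _ _ _ tphi).
exact: partial_eq0.
Qed.

(** The definition of convergence only asks the limit to be measurable; it is
    square integrable because it differs from some f k by a square integrable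
    function. *)
Lemma cvg_L2P (f : nat -> 'rV[R]_d -> R) g : (forall k, L2 (f k)) ->
  cvg_L2 Omega f g <-> L2 g /\
    ip (fun x => f k x - g x) (fun x => f k x - g x) @[k --> \oo] --> (0 : R).
Proof.
move=> Lf.
have E : L2 g -> forall k, (\int[mu]_(x in Omega) ((f k x - g x) ^+ 2)%:E =
    (ip (fun x => f k x - g x) (fun x => f k x - g x))%:E)%E.
  move=> Lg k; have Lfg := L2B mO (Lf k) Lg.
  rewrite /ip /Rintegral fineK; last first.
    by apply: integrable_fin_num => //; exact: L2_integrableM.
  by apply: eq_integral => x _; rewrite expr2.
split=> [[mg fg]|[Lg fg]]; last first.
  split; first by have [] := Lg.
  under eq_fun do rewrite E//.
  by apply/fine_cvgP; split; [exact: nearW|exact: fg].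
have Lg : L2 g.
  have [k kfg] : exists k, (\int[mu]_(x in Omega) ((f k x - g x) ^+ 2)%:E < +oo)%E.
    have : \forall k \near \oo,
        ((\int[mu]_(x in Omega) ((f k x - g x) ^+ 2)%:E)%E \is a fin_num).
      by have /fine_cvgP[] := fg.
    by move=> /filter_ex[k kfin]; exists k; rewrite ltey_eq kfin.
  have Lfg : L2 (fun x => f k x - g x).
    by split=> //; apply: measurable_funB => //; have [] := Lf k.
  apply: L2_ext (L2B mO (Lf k) Lfg) => x; ring.
split=> //.
have -> : (fun k => ip (fun x => f k x - g x) (fun x => f k x - g x)) =
    fine \o (fun k => \int[mu]_(x in Omega) ((f k x - g x) ^+ 2)%:E)%E.
  by apply/funext => k /=; rewrite E.
exact: (fine_cvg fg).
Qed.

Lemma iter_partial_lin (f g : 'rV[R]_d -> R) (a b : R) s : smooth f -> smooth g ->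
  iter_partial s (fun x => a * f x + b * g x) =
  (fun x => a * iter_partial s f x + b * iter_partial s g x).
Proof.
move=> sf sg; elim: s => [//|i s IHs]; rewrite /= IHs; apply/funext => x.
by have [_] := is_derive_lin a b ((sf s).2 i x) ((sg s).2 i x).
Qed.

Lemma smooth_lin (f g : 'rV[R]_d -> R) (a b : R) : smooth f -> smooth g ->
  smooth (fun x => a * f x + b * g x).
Proof.
move=> sf sg s; rewrite iter_partial_lin//; split=> [|i x].
  by apply: continuous_lin; [exact: (sf s).1|exact: (sg s).1].
by have [] := is_derive_lin a b ((sf s).2 i x) ((sg s).2 i x).
Qed.

Lemma test_function_lin f g (a b : R) : test_function Omega f -> test_function Omega g ->
  test_function Omega (fun x => a * f x + b * g x).
Proof.
move=> tf tg; pose K := closure [set x | f x != 0] `|` closure [set x | g x != 0].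
have cK : compact K by apply: compactU; [exact: test_function_compact tf|exact: test_function_compact tg].
have sK : closure [set x | a * f x + b * g x != 0] `<=` K.
  rewrite closureEbigcap; apply: bigcap_inf; split; last first.
    move=> x; apply: contraPP => /not_orP[/test_function_eq0 f0 /test_function_eq0 g0].
    by rewrite /= f0 g0 !mulr0 addr0 eqxx.
  by apply: closedU; exact: closed_closure.
split.
- by apply: smooth_lin; [have [] := tf|have [] := tg].
- by apply: subclosed_compact cK sK; exact: closed_closure.
- by move=> x /sK[/(test_function_sub tf)|/(test_function_sub tg)].
Qed.

Lemma partial_lin f g (a b : R) i : test_function Omega f -> test_function Omega g ->
  partial i (fun x => a * f x + b * g x) =
  (fun x => a * partial i f x + b * partial i g x).
Proof. by move=> [sf _ _] [sg _ _]; exact: (iter_partial_lin a b [:: i] sf sg). Qed.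

Lemma H10_L2 u D : H10 Omega u D -> L2 u /\ forall i, L2 (D i).
Proof.
move=> [phi [tphi cu cD]]; split=> [|i].
  by have /(cvg_L2P _ (fun k => test_function_L2 (tphi k)))[] := cu.
by have /(cvg_L2P _ (fun k => partial_L2 i (tphi k)))[] := cD i.
Qed.

Lemma cvg_L2_lin (f1 f2 : nat -> 'rV[R]_d -> R) g1 g2 (a b : R) :
  (forall k, L2 (f1 k)) -> (forall k, L2 (f2 k)) ->
  cvg_L2 Omega f1 g1 -> cvg_L2 Omega f2 g2 ->
  cvg_L2 Omega (fun k x => a * f1 k x + b * f2 k x) (fun x => a * g1 x + b * g2 x).
Proof.
move=> Lf1 Lf2 /(cvg_L2P _ Lf1)[Lg1 c1] /(cvg_L2P _ Lf2)[Lg2 c2].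
apply/cvg_L2P; first by move=> k; exact: L2_lin.
split; first exact: L2_lin.
set F := fun k => _.
have c3 : (2 * a ^+ 2 * ip (fun x => f1 k x - g1 x) (fun x => f1 k x - g1 x) +
   2 * b ^+ 2 * ip (fun x => f2 k x - g2 x) (fun x => f2 k x - g2 x))
   @[k --> \oo] --> (0 : R).
  rewrite -[X in _ --> X]addr0; apply: cvgD.
    by rewrite -[X in _ --> X](mulr0 (2 * a ^+ 2)); apply: cvgMr.
  by rewrite -[X in _ --> X](mulr0 (2 * b ^+ 2)); apply: cvgMr.
apply: (squeeze_cvgr _ (cvg_cst 0) c3); near=> k; apply/andP; split.
  exact: ip_ge0.
have L1 := L2B mO (Lf1 k) Lg1; have L2' := L2B mO (Lf2 k) Lg2.
set A := fun x => f1 k x - g1 x in L1 *; set B := fun x => f2 k x - g2 x in L2' *.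
have -> : F k = ip (fun x => a * A x + b * B x) (fun x => a * A x + b * B x).
  by congr (ip _ _); apply/funext => x; rewrite /A /B; ring.
have := ip_ge0 mu Omega (fun x => a * A x + (- b) * B x).
by rewrite !ip_lin_sqr//; lra.
Unshelve. all: end_near. Qed.

Lemma H10_lin u v D E (a b : R) : H10 Omega u D -> H10 Omega v E ->
  H10 Omega (fun x => a * u x + b * v x) (fun i x => a * D i x + b * E i x).
Proof.
move=> [phi [tphi cu cD]] [psi [tpsi cv cE]].
exists (fun k x => a * phi k x + b * psi k x); split=> [k||i].
- exact: test_function_lin.
- by apply: cvg_L2_lin => // k; exact: test_function_L2.
rewrite (_ : (fun k => _) = fun k x => a * partial i (phi k) x + b * partial i (psi k) x).
  by apply: cvg_L2_lin => // k; exact: partial_L2.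
by apply/funext => k; exact: partial_lin.
Qed.

(** An eigenfunction with a choice of its weak gradient, and the weak equation
    written with inner products. *)
Definition eigenpair (t : R) u D := H10 Omega u D /\
  forall psi, test_function Omega psi ->
      \sum_i ip (D i) (partial i psi) = t * ip u psi.

Lemma dirichlet_eigenspaceE t u :
  dirichlet_eigenspace Omega t u <-> exists D, eigenpair t u D.
Proof.
have E D psi : H10 Omega u D -> test_function Omega psi ->
    \int[mu]_(x in Omega) (\sum_i D i x * partial i psi x) =
    \sum_i ip (D i) (partial i psi).
  move=> /H10_L2[_ LD] tpsi.
  have iD i : mu.-integrable Omega (EFin \o (fun x => D i x * partial i psi x)).
    by apply: L2_integrableM => //; exact: partial_L2.
  have iS r : mu.-integrable Omega
      (EFin \o (fun x => \sum_(i <- r) D i x * partial i psi x)).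
    elim: r => [|i r IHr].
      rewrite (_ : _ \o _ = cst 0%E); first exact: integrable0.
      by apply/funext => x /=; rewrite big_nil.
    rewrite (_ : _ \o _ = ((EFin \o (fun x => D i x * partial i psi x)%R) \+
      (EFin \o (fun x => \sum_(i <- r) D i x * partial i psi x)%R))%E).
      exact: integrableD.
    by apply/funext => x /=; rewrite big_cons.
  rewrite /ip; elim: (index_enum _) => [|i r IHr].
    rewrite big_nil /Rintegral integral0_eq// => x _; by rewrite big_nil.
  rewrite big_cons -IHr -RintegralD//.
  by apply: eq_Rintegral => x _; rewrite big_cons.
split=> -[D [HD w]]; exists D; split=> // psi tpsi.
  by rewrite -E// w.
by rewrite E// w.
Qed.

Lemma eigenpair_lin t u v D E (a b : R) : eigenpair t u D -> eigenpair t v E ->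
  eigenpair t (fun x => a * u x + b * v x) (fun i x => a * D i x + b * E i x).
Proof.
move=> [Hu wu] [Hv wv]; split; first exact: H10_lin.
move=> psi tpsi; have [Lu LD] := H10_L2 Hu; have [Lv LE] := H10_L2 Hv.
have Lp := test_function_L2 tpsi.
rewrite (ip_linl mO)//.
have lin i : ip (fun x => a * D i x + b * E i x) (partial i psi) =
    a * ip (D i) (partial i psi) + b * ip (E i) (partial i psi).
  by apply: ip_linl => //; exact: partial_L2.
under eq_bigr do rewrite lin.
rewrite big_split/= -!mulr_sumr wu// wv//; ring.
Qed.

(** The weak equation extends from test functions to all of H10 by density. *)
Lemma eigenpair_H10 t u v D E : eigenpair t u D -> H10 Omega v E ->
  \sum_i ip (D i) (E i) = t * ip u v.
Proof.
move=> [Hu wu] Hv; have [Lu LD] := H10_L2 Hu; have [Lv LE] := H10_L2 Hv.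
have [psi [tpsi cv cE]] := Hv.
have Lpsi k : L2 (psi k) by exact: test_function_L2.
have Ldpsi i k : L2 (partial i (psi k)) by exact: partial_L2.
have [_ cv'] := (cvg_L2P _ Lpsi).1 cv.
have c0 (f : 'rV[R]_d -> R) : ip (fun x => f x - f x) (fun x => f x - f x)
    @[k --> \oo] --> (0 : R).
  rewrite (_ : (fun x => f x - f x) = cst 0); last first.
    by apply/funext => x; rewrite subrr.
  by rewrite ip0l; exact: cvg_cst.
have H1 : t * ip u (psi k) @[k --> \oo] --> t * ip u v.
  apply: cvgMr; exact: (ip_cvg mO (fun=> Lu) Lpsi Lu Lv (c0 u) cv').
have H2 : (\sum_i ip (D i) (partial i (psi k))) @[k --> \oo] --> \sum_i ip (D i) (E i).
  apply: cvgn_sum => i.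
  have [_ cE'] := (cvg_L2P _ (Ldpsi i)).1 (cE i).
  exact: (ip_cvg mO (fun=> LD i) (Ldpsi i) (LD i) (LE i) (c0 (D i)) cE').
have {}H2 : t * ip u (psi k) @[k --> \oo] --> \sum_i ip (D i) (E i).
  by under eq_fun do rewrite -wu//.
exact: (cvg_unique _ H2 H1).
Qed.

(** The Dirichlet form is symmetric, so s <u, v> = t <u, v>. *)
Lemma eigenpair_orthogonal s t u v D E : s != t ->
  eigenpair s u D -> eigenpair t v E -> ip u v = 0.
Proof.
move=> st eu ev; have H1 := eigenpair_H10 eu ev.1; have H2 := eigenpair_H10 ev eu.1.
have : (s - t) * ip u v = 0.
  rewrite mulrBl -H1 [ip u v]ipC -H2 -sumrB big1// => i _.
  by rewrite [ip (E i) _]ipC subrr.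
by move=> /eqP; rewrite mulf_eq0 subr_eq0 (negbTE st) => /eqP.
Qed.

End eigenspaces.

(** * Orthonormal eigenfunctions and the sum of the first eigenvalues *)

Section eigenfamily.
Context {R : realType} {d : nat}.
Local Notation mu := (@lebesgue_rV R d).
Variables (Omega : set 'rV[R]_d).
Hypotheses (Omega_open : open Omega) (Omega_bounded : bounded_set Omega).
Local Notation ip := (ip mu Omega).
Local Notation eigenpair := (eigenpair Omega).

Let mO : measurable Omega.
Proof. exact: open_measurable_rV. Qed.

Lemma eigenpair_sum (t : R) m (e : 'I_m -> 'rV[R]_d -> R) D (c : 'I_m -> R) :
  (0 < m)%N -> (forall j, eigenpair t (e j) (D j)) ->
  eigenpair t (fun x => \sum_j c j * e j x) (fun i x => \sum_j c j * D j i x).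
Proof.
move=> m0 eD; pose j0 := Ordinal m0.
elim: (index_enum _) => [|j r IHr].
  have := eigenpair_lin Omega_open Omega_bounded 0 0 (eD j0) (eD j0).
  by congr (eigenpair t _ _); apply/funext => i; rewrite ?big_nil ?mul0r ?addr0//;
     apply/funext => x; rewrite big_nil !mul0r addr0.
have := eigenpair_lin Omega_open Omega_bounded (c j) 1 (eD j) IHr.
by congr (eigenpair t _ _); apply/funext => i; rewrite ?big_cons ?mul1r//;
     apply/funext => x; rewrite big_cons mul1r.
Qed.

(** Fewer equations than unknowns. *)
Lemma nonzero_kernel (F : fieldType) m r (A : 'M[F]_(m, r)) : (r < m)%N ->
  exists2 c : 'rV[F]_m, c != 0 & c *m A = 0.
Proof.
move=> rm; have : kermx A != 0.
  by rewrite -mxrank_eq0 mxrank_ker subn_eq0 -ltnNge (leq_ltn_trans (rank_leq_col A)).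
by move=> /rowV0Pn[c /sub_kermxP cA c0]; exists c.
Qed.

Lemma uniq_size_le_card (A : set nat) m (s : seq nat) :
  (A #= `I_m)%card -> uniq s -> {in s, forall k, A k} -> (size s <= m)%N.
Proof.
move=> /card_set_bijP[f [fsub finj _]] us sA.
rewrite -(size_map f) -(size_iota 0 m); apply: uniq_leq_size.
  by rewrite map_inj_in_uniq// => x y /sA Ax /sA Ay; apply: finj; rewrite inE.
by move=> _ /mapP[k /sA Ak ->]; rewrite mem_iota/=; apply: fsub.
Qed.

Variables (lambda : nat -> R).
Hypothesis lambdaP : dirichlet_eigenvalues Omega lambda.

(** The eigenvalue t = lambda n occurs at fewer than m earlier indices, where m
    is its multiplicity.  Hence some nonzero combination of the m basis functions
    of its eigenspace is orthogonal to all earlier functions with eigenvalue t;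
    it is orthogonal to the others by eigenpair_orthogonal. *)
Lemma new_eigenpair n (g : nat -> 'rV[R]_d -> R) D :
  (forall k, (k < n)%N -> eigenpair (lambda k) (g k) (D k)) ->
  exists u E, [/\ eigenpair (lambda n) u E, ip u u = 1 &
    forall k, (k < n)%N -> ip u (g k) = 0].
Proof.
move=> gD; have [_ /(_ (lambda n))[m [[e [eE efree _]] cardm]]] := lambdaP.
set t := lambda n in eE cardm *.
pose s := [seq k <- iota 0 n | lambda k == t].
have sm : (size s < m)%N.
  apply: (@uniq_size_le_card _ _ (n :: s) cardm).
    by rewrite /= mem_filter mem_iota add0n ltnn !andbF filter_uniq ?iota_uniq.
  by move=> k; rewrite inE mem_filter => /orP[/eqP->//|/andP[/eqP]].
have m0 : (0 < m)%N by exact: leq_ltn_trans sm.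
have /choice[De eD] : forall j, exists De, eigenpair t (e j) De.
  by move=> j; apply/dirichlet_eigenspaceE.
have Le j : L2 mu Omega (e j) by have [/(H10_L2 Omega_open Omega_bounded)[]] := eD j.
have [c c0 cA] := nonzero_kernel
  (\matrix_(j < m, a < size s) ip (e j) (g (nth 0 s a))) sm.
pose u0 x := \sum_j c 0 j * e j x.
have eu0 := eigenpair_sum (fun j => c 0 j) m0 eD.
have Lu0 : L2 mu Omega u0 by have [/(H10_L2 Omega_open Omega_bounded)[]] := eu0.
have Lg k : (k < n)%N -> L2 mu Omega (g k).
  by move=> /gD[/(H10_L2 Omega_open Omega_bounded)[]].
have u0g k : (k < n)%N -> ip u0 (g k) = 0.
  move=> kn; have [kt|kt] := eqVneq (lambda k) t; last first.
    apply: (eigenpair_orthogonal Omega_open Omega_bounded _ eu0 (gD k kn)).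
    by rewrite eq_sym.
  have ks : k \in s by rewrite mem_filter kt eqxx mem_iota.
  have ks' : (index k s < size s)%N by rewrite index_mem.
  rewrite /u0 ip_suml//; last exact: Lg.
  move/rowP/(_ (Ordinal ks')) : cA; rewrite !mxE => E.
  rewrite -[RHS]E; apply: eq_bigr => j _.
  by rewrite mxE /= nth_index.
have u00 : 0 < ip u0 u0.
  rewrite lt0r ip_ge0 andbT; apply/eqP => /(ip_eq0_ae mO Lu0) /efree H.
  by move/eqP : c0; apply; apply/rowP => j; rewrite H mxE.
pose a := (Num.sqrt (ip u0 u0))^-1.
have eu := eigenpair_lin Omega_open Omega_bounded a 0 eu0 eu0.
exists (fun x => a * u0 x + 0 * u0 x); eexists; split.
- exact: eu.
- rewrite ip_lin_sqr// !mulr0 mul0r expr0n/= mul0r !addr0 /a exprVn.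
  by rewrite sqr_sqrtr ?ip_ge0// mulVf// gt_eqF.
- by move=> k kn; rewrite ip_linl//; [rewrite u0g// !mulr0 addr0|exact: Lg].
Qed.

Lemma orthonormal_eigenfamily n : exists (g : nat -> 'rV[R]_d -> R) D,
  (forall k, (k < n)%N -> eigenpair (lambda k) (g k) (D k)) /\
  (forall k l, (k < n)%N -> (l < n)%N -> ip (g k) (g l) = (k == l)%:R).
Proof.
elim: n => [|n [g [D [gD gon]]]].
  by exists (fun=> cst 0), (fun=> fun=> cst 0).
have [u [E [uE u1 ug]]] := new_eigenpair gD.
exists (fun k => if k == n then u else g k), (fun k => if k == n then E else D k).
split=> [k|k l].
  have [->|kn] := eqVneq k n; first by move=> _; exact: uE.
  by rewrite ltnS leq_eqVlt (negbTE kn) => kn'; exact: gD kn'.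
rewrite !ltnS.
have [->|kn] := eqVneq k n; have [->|ln] := eqVneq l n => /=.
- by move=> _ _; rewrite u1.
- by rewrite [(l <= n)%N]leq_eqVlt (negbTE ln) => _ ?; rewrite ug// eq_sym (negbTE ln).
- by rewrite leq_eqVlt (negbTE kn) => ? _; rewrite ipC ug// (negbTE kn).
- rewrite leq_eqVlt (negbTE kn) => k1; rewrite leq_eqVlt (negbTE ln) => l1.
  exact: gon.
Qed.

(** Approximate the eigenfunctions by test functions: Gram matrices tend to the
    identity and energies to the eigenvalues. *)
Lemma eigen_berezin (z : R) n : 0 < z ->
  \sum_(k < n) (z - lambda k) <= fine (mu Omega) *
    ((2 * pi) ^- d * ((z * z `^ (d%:R / 2)) * fine (@riesz_volume R d))).
Proof.
move=> z0; have [g [D [gD gon]]] := orthonormal_eigenfamily n.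
set C := (X in _ <= X).
have V0 : 0 <= fine (@riesz_volume R d).
  by apply: fine_ge0; apply: integral_ge0 => v _; rewrite lee_fin le_max lexx.
have C0 : 0 <= C.
  apply: mulr_ge0; first by rewrite fine_ge0.
  apply: mulr_ge0.
    by rewrite invr_ge0 exprn_ge0// mulr_ge0// pi_ge0.
  apply: mulr_ge0; last exact: V0.
  by rewrite mulr_ge0 ?powR_ge0// ltW.
have H10g (k : 'I_n) : H10 Omega (g k) (D k) by have [] := gD k (ltn_ord k).
have /choice[phi phiP] := H10g.
have tphi k p : test_function Omega (phi k p) by have [] := phiP k.
have Lphi k p := test_function_L2 Omega_open Omega_bounded (tphi k p).
have Ldphi k i p := partial_L2 Omega_open Omega_bounded i (tphi k p).
have Lg (k : 'I_n) := H10_L2 Omega_open Omega_bounded (H10g k).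
have cphi k u := (cvg_L2P Omega_open u (Lphi k)).1.
have cip j l : ip (phi j p) (phi l p) @[p --> \oo] --> ((j == l)%:R : R).
  have -> : ((j == l)%:R : R) = ip (g j) (g l) by rewrite gon.
  have [_ cj _] := phiP j; have [_ cl _] := phiP l.
  have [_ cj'] := cphi _ _ cj; have [_ cl'] := cphi _ _ cl.
  exact: (ip_cvg mO (Lphi j) (Lphi l) (Lg j).1 (Lg l).1 cj' cl').
have cen j : (\sum_i ip (partial i (phi j p)) (partial i (phi j p))) @[p --> \oo]
    --> lambda j.
  have -> : lambda j = \sum_i ip (D j i) (D j i).
    rewrite (eigenpair_H10 Omega_open Omega_bounded (gD j (ltn_ord j)) (H10g j)).
    by rewrite gon// eqxx mulr1.
  apply: cvgn_sum => i; have [_ _ /(_ i) cj] := phiP j.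
  have [_ cj'] := (cvg_L2P Omega_open (D j i) (Ldphi j i)).1 cj.
  exact: (ip_cvg mO (Ldphi j i) (Ldphi j i) ((Lg j).2 i) ((Lg j).2 i) cj' cj').
have cl : (\sum_(j < n) (z * ip (phi j p) (phi j p) -
    \sum_i ip (partial i (phi j p)) (partial i (phi j p)))) @[p --> \oo] -->
    \sum_(j < n) (z - lambda j).
  apply: cvgn_sum => j; apply: cvgB; last exact: cen.
  by rewrite -[X in _ --> X](mulr1 z); apply: cvgMr; have := cip j j; rewrite eqxx.
have le_eps eps : 0 < eps -> \sum_(k < n) (z - lambda k) <= (1 + eps * n%:R) * C.
  move=> eps0; apply: (cvgr_to_le cl).
  have gram : \forall p \near \oo, forall j l, `|ip (phi j p) (phi l p) - (j == l)%:R| <= eps.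
    apply: filter_forall => j; apply: filter_forall => l.
    by have /cvgrPdist_le/(_ _ eps0) := cip j l; apply: filterS => p; rewrite distrC.
  apply: filterS gram => p gram.
  have := test_function_berezin Omega_open Omega_bounded z0 (ltW eps0)
    (fun j => tphi j p) gram.
  rewrite card_ord -mulrA -/C; apply: le_trans.
  rewrite le_eqVlt; apply/orP; left; apply/eqP.
  apply: eq_bigr => j _; congr (_ - _); apply: eq_bigr => i _.
apply/ler_addgt0Pr => e e0.
have nC : 0 < n%:R * C + 1 by rewrite ltr_wpDl// mulr_ge0.
apply: (le_trans (le_eps (e / (n%:R * C + 1)) _)); first by rewrite divr_gt0.
rewrite mulrDl mul1r lerD2l -mulrA mulrAC ler_pdivrMr// ler_pM2l//.
by rewrite lerDl.
Qed.

End eigenfamily.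

(** * The arithmetic-geometric mean inequality and the Gamma integral *)

Section gamma.
Context {R : realType}.
Local Notation mu := (@lebesgue_measure R).

Lemma weighted_amgm (p x y : R) : 0 <= p <= 1 -> 0 < x -> 0 < y ->
  x `^ p * y `^ (1 - p) <= p * x + (1 - p) * y.
Proof.
move=> /andP[p0 p1] x0 y0.
have [->|pn0] := eqVneq p 0.
  by rewrite powRr0 subr0 powRr1 ?(ltW x0) ?(ltW y0)// mul0r add0r mul1r lexx.
have [->|pn1] := eqVneq p 1.
  by rewrite powRr1 ?(ltW x0) ?(ltW y0)// subrr powRr0 mul0r addr0 mul1r mulr1 lexx.
have {}p0 : 0 < p by rewrite lt0r pn0.
have {}p1 : 0 < 1 - p by rewrite subr_gt0 lt_neqAle pn1.
have := @conjugate_powR R (x `^ p) (y `^ (1 - p)) p^-1 (1 - p)^-1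
  (powR_ge0 _ _) (powR_ge0 _ _).
have pq : p + (1 - p) = 1 by ring.
rewrite !invr_gt0 !invrK => /(_ p0 p1 pq).
by rewrite -!powRrM !divff ?gt_eqF// !powRr1 ?(ltW x0) ?(ltW y0)// [x * _]mulrC [y * _]mulrC.
Qed.

(** Apply weighted_amgm to x / p and y / (1 - p).  The form is chosen so that the
    right-hand side is a multiple of x + y. *)
Lemma scaled_amgm (p x y : R) : 0 <= p < 1 -> 0 < x -> 0 < y ->
  x `^ p * y `^ (1 - p) <= p `^ p * (1 - p) `^ (1 - p) * (x + y).
Proof.
move=> /andP[p0 p1] x0 y0; have q0 : 0 < 1 - p by rewrite subr_gt0.
have [->|pn0] := eqVneq p 0.
  by rewrite subr0 !powRr0 !powRr1 ?ler01 ?(ltW x0) ?(ltW y0)// !mul1r lerDr ltW.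
have {}p0 : 0 < p by rewrite lt0r pn0.
have [X X0 ->] : exists2 X, 0 < X & x = p * X.
  by exists (x / p); [rewrite divr_gt0|rewrite mulrC divfK// gt_eqF].
have [Y Y0 ->] : exists2 Y, 0 < Y & y = (1 - p) * Y.
  by exists (y / (1 - p)); [rewrite divr_gt0|rewrite mulrC divfK// gt_eqF].
rewrite (powRM _ (ltW p0) (ltW X0)) (powRM _ (ltW q0) (ltW Y0)) mulrACA.
rewrite ler_pM2l; last by rewrite mulr_gt0// powR_gt0.
by apply: weighted_amgm => //; rewrite (ltW p0) (ltW p1).
Qed.

(** Euler's integral for Gamma (1 + r) in the extended reals, where divergence is
    visible. *)
Definition gamma_int (r : R) : \bar R :=
  (\int[mu]_(t in `]0%R, +oo[) (t `^ r * expR (- t))%:E)%E.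

Lemma GammaE (r : R) : Gamma (1 + r) = fine (gamma_int r).
Proof.
by rewrite /Gamma /Rintegral /gamma_int [1 + r]addrC addrK.
Qed.

Lemma measurable_gamma (r : R) (D : set (measurableTypeR R)) : measurable D ->
  measurable_fun D (fun t : R => (t `^ r * expR (- t))%:E).
Proof.
move=> mD; apply/measurable_EFinP; apply: measurable_funM.
  by apply: measurable_funTS; exact: measurable_powR.
by apply: measurable_funTS; apply: measurableT_comp.
Qed.

Lemma gamma_int_ge0 r : (0 <= gamma_int r)%E.
Proof.
by apply: integral_ge0 => t _; rewrite lee_fin mulr_ge0 ?powR_ge0 ?expR_ge0.
Qed.

Lemma gamma_int1 : gamma_int 1 = 1%E.
Proof.
rewrite /gamma_int.
have := @integral_tail R 0; rewrite [in X in _ = X]oppr0 expR0 => <-.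
rewrite -integral_itv_obnd_cbnd; last first.
  apply/measurable_EFinP; apply: measurable_funM.
    by apply: measurable_funB.
  by apply: measurable_funTS; apply: measurableT_comp.
apply: eq_integral => t; rewrite inE/= in_itv/= andbT => t0.
by rewrite powRr1 ?ltW// subr0.
Qed.

Lemma gamma_int0 : gamma_int 0 = 1%E.
Proof.
rewrite /gamma_int.
pose F (x : R) := - expR (- x).
have F0 : F x @[x --> +oo] --> (0 : R).
  by rewrite -[X in _ --> X]oppr0; apply: cvgN; exact: cvgr_expR.
have dF (x : R) : is_derive x 1 F (expR (- x)).
  by rewrite /F; apply: is_derive_eq; rewrite /GRing.scale/=; ring.
transitivity (\int[mu]_(t in `[0%R, +oo[) (expR (- t))%:E)%E.
  rewrite -integral_itv_obnd_cbnd; last first.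
    by apply/measurable_EFinP; apply: measurable_funTS; apply: measurableT_comp.
  by apply: eq_integral => t _; rewrite powRr0 mul1r.
rewrite (@ge0_continuous_FTC2y _ _ F 0 0).
- by rewrite /F oppr0 expR0 sub0e -EFinN opprK.
- by move=> x _; exact: expR_ge0.
- apply: continuous_subspaceT => x; apply: continuous_comp.
    exact: opp_continuous.
  exact: continuous_expR.
- exact: F0.
- by move=> x _; apply: ex_derive.
- apply: cvg_at_right_filter; apply: differentiable_continuous.
  by apply/derivable1_diffP; apply: ex_derive.
- by move=> x _; rewrite derive1E; apply: derive_val.
Qed.

(** Compare t^r with 1 + t. *)
Lemma gamma_int_fin (r : R) : 0 <= r <= 1 -> gamma_int r \is a fin_num.
Proof.
move=> r01; rewrite ge0_fin_numE ?gamma_int_ge0//.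
apply: (@le_lt_trans _ _ (gamma_int 0 + gamma_int 1)%E); last first.
  by rewrite gamma_int0 gamma_int1 -EFinD ltry.
rewrite /gamma_int -ge0_integralD//=; last 4 first.
- by move=> t _; rewrite lee_fin mulr_ge0 ?powR_ge0 ?expR_ge0.
- exact: measurable_gamma.
- by move=> t _; rewrite lee_fin mulr_ge0 ?powR_ge0 ?expR_ge0.
- exact: measurable_gamma.
apply: ge0_le_integral => //.
- by move=> t _; rewrite lee_fin mulr_ge0 ?powR_ge0 ?expR_ge0.
- exact: measurable_gamma.
- by apply: emeasurable_funD; exact: measurable_gamma.
move=> t /=; rewrite in_itv/= andbT => t0.
rewrite -EFinD lee_fin -mulrDl ler_pM2r ?expR_gt0// powRr0 powRr1 ?(ltW t0)//.
have := weighted_amgm r01 t0 ltr01; rewrite powR1 mulr1 => H.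
by apply: (le_trans H); move/andP: r01 => [? ?]; nra.
Qed.

Lemma gamma_int_scale (r c : R) : 0 < c ->
  (\int[mu]_(t in `]0%R, +oo[) (t `^ r * expR (- (c * t)))%:E =
   (c `^ (- (1 + r)))%:E * gamma_int r)%E.
Proof.
move=> c0; pose f : R -> \bar R := (fun t => (t `^ r * expR (- t))%:E) \_ `]0, +oo[.
have mf : measurable_fun setT (f : measurableTypeR R -> \bar R).
  apply/(measurable_restrictT (fun t : measurableTypeR R => (t `^ r * expR (- t))%:E)) => //.
  exact: measurable_gamma.
have f0 t : (0 <= f t)%E.
  by rewrite /f patchE; case: ifP => // _; rewrite lee_fin mulr_ge0 ?powR_ge0 ?expR_ge0.
have E : (\int[mu]_x f (c * x)%R = c^-1%:E * gamma_int r)%E.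
  by rewrite (ge0_integral_scale1 c0 mf f0) /gamma_int [in RHS]integral_mkcond.
have -> : c `^ (- (1 + r)) = c `^ (- r) * c^-1.
  have -> : - (1 + r) = - r - 1 by ring.
  rewrite powRD; last by rewrite (gt_eqF c0) implybT.
  by rewrite [c `^ (-1)]powR_inv1// ltW.
have mfc : measurable_fun setT (fun t : measurableTypeR R => f (c * t)).
  by apply: (measurableT_comp mf); exact: mulrl_measurable.
rewrite EFinM -muleA -E -(ge0_integralZl mu measurableT mfc (fun t _ => f0 (c * t))); last first.
  by rewrite lee_fin powR_ge0.
rewrite [LHS]integral_mkcond; apply: eq_integral => t _.
rewrite /f !patchE !mem_setE !in_itv/= !andbT pmulr_rgt0//.
case: ifPn => t0; last by rewrite mule0.
have cc : c `^ (- r) * c `^ r = 1 by rewrite powRN mulVf// gt_eqF// powR_gt0.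
rewrite -EFinM; congr EFin.
by rewrite (powRM _ (ltW c0) (ltW t0)) !mulrA cc mul1r.
Qed.

End gamma.

(** * Lower bounds for the Gamma function *)

Section gamma_bounds.
Context {R : realType}.
Local Notation mu := (@lebesgue_measure R).

Let g0 (r : R) (t : R) : (0%:E <= (t `^ r * expR (- t))%:E)%E.
Proof. by rewrite lee_fin mulr_ge0 ?powR_ge0 ?expR_ge0. Qed.

Lemma gamma_int_lin (a b r s : R) : 0 <= a -> 0 <= b ->
  (\int[mu]_(t in `]0%R, +oo[)
     (a * (t `^ r * expR (- t)) + b * (t `^ s * expR (- t)))%:E =
   a%:E * gamma_int r + b%:E * gamma_int s)%E.
Proof.
move=> a0 b0; under eq_integral do rewrite EFinD !EFinM.
have mI : measurable (`]0%R, +oo[%classic : set (measurableTypeR R)) by [].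
have m1 := measurable_gamma r mI; have m2 := measurable_gamma s mI.
rewrite ge0_integralD//=.
- rewrite (ge0_integralZl mu mI m1 (fun t _ => g0 r t)) ?lee_fin//.
  by rewrite (ge0_integralZl mu mI m2 (fun t _ => g0 s t)) ?lee_fin.
- by move=> t _; rewrite mule_ge0 ?lee_fin// mulr_ge0 ?powR_ge0 ?expR_ge0.
- by apply/measurable_EFinP; apply: measurable_funM => //; exact/measurable_EFinP.
- by move=> t _; rewrite mule_ge0 ?lee_fin// mulr_ge0 ?powR_ge0 ?expR_ge0.
- by apply/measurable_EFinP; apply: measurable_funM => //; exact/measurable_EFinP.
Qed.

(** One half of the functional equation Gamma (2 + r) = (1 + r) Gamma (1 + r), by
    differentiating the scaling law.  With c = 1 / (1 + x), the inequality
    exp(-c t) >= exp(-t) (1 + (1 - c) t) bounds the scaled integral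
    (1 + x)^(1 + r) * gamma_int r from below by
    gamma_int r + (1 - c) * gamma_int (1 + r); expand for small x. *)
Lemma gamma_int_succ_fin_le (r : R) : 0 <= r <= 1 ->
  gamma_int (1 + r) \is a fin_num /\
  fine (gamma_int (1 + r)) <= (1 + r) * fine (gamma_int r).
Proof.
move=> r01; have /andP[r0 r1] := r01.
have gfin := gamma_int_fin r01.
have := fineK gfin; have : 0 <= fine (gamma_int r) by rewrite fine_ge0// gamma_int_ge0.
move: (fine (gamma_int r)) => A A0 gA.
have main x : 0 < x -> ((1 * A)%:E + (1 - (1 + x)^-1)%:E * gamma_int (1 + r) <=
    ((1 + x) `^ (1 + r) * A)%:E)%E.
  move=> x0; have x1 : 0 < 1 + x by rewrite ltr_wpDl.
  have c0 : 0 < (1 + x)^-1 by rewrite invr_gt0.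
  have c1 : 0 <= 1 - (1 + x)^-1.
    by rewrite subr_ge0 invf_le1// lerDl ltW.
  have cE : (1 + x)^-1 `^ (- (1 + r)) = (1 + x) `^ (1 + r).
    by rewrite -(powR_inv1 (ltW x1)) -powRrM; congr (_ `^ _); ring.
  have -> : (((1 + x) `^ (1 + r) * A)%:E =
      \int[mu]_(t in `]0%R, +oo[) (t `^ r * expR (- ((1 + x)^-1 * t)))%:E)%E.
    by rewrite (gamma_int_scale r c0) cE EFinM gA.
  rewrite EFinM gA -gamma_int_lin//.
  have mI : measurable (`]0%R, +oo[%classic : set (measurableTypeR R)) by [].
  have m1 := measurable_gamma r mI; have m2 := measurable_gamma (1 + r) mI.
  apply: ge0_le_integral => //.
  - by move=> t _; rewrite lee_fin addr_ge0 ?mulr_ge0 ?powR_ge0 ?expR_ge0.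
  - apply/measurable_EFinP; apply: measurable_funD; apply: measurable_funM => //;
      exact/measurable_EFinP.
  - apply/measurable_EFinP; apply: measurable_funM.
      by apply: measurable_funTS; exact: measurable_powR.
    apply: measurable_funTS; apply: measurableT_comp => //.
    by apply: measurableT_comp => //; exact: mulrl_measurable.
  move=> t /=; rewrite in_itv/= andbT => t0; rewrite lee_fin.
  have -> : t `^ (1 + r) = t * t `^ r.
    by rewrite powRD ?(gt_eqF t0) ?implybT// powRr1// ltW.
  have -> : expR (- ((1 + x)^-1 * t)) = expR (- t) * expR ((1 - (1 + x)^-1) * t).
    by rewrite -expRD; congr expR; ring.
  have := expR_ge1Dx ((1 - (1 + x)^-1) * t).
  have tr : 0 <= t `^ r * expR (- t) by rewrite mulr_ge0 ?powR_ge0 ?expR_ge0.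
  move: (expR ((1 - (1 + x)^-1) * t)) (1 - (1 + x)^-1) => E c tE.
  rewrite [leRHS]mulrA.
  apply: (@le_trans _ _ (t `^ r * expR (- t) * (1 + c * t))).
    by rewrite le_eqVlt; apply/orP; left; apply/eqP; ring.
  by rewrite ler_wpM2l.
have gsfin : gamma_int (1 + r) \is a fin_num.
  rewrite ge0_fin_numE ?gamma_int_ge0// ltey; apply/eqP => goo.
  have p2 : (0 < (1 - (1 + 1)^-1 : R)%:E)%E.
    by rewrite lte_fin subr_gt0 invf_lt1// ltrDl.
  have := main 1 ltr01; rewrite goo (gt0_muley p2).
  by rewrite addey// leye_eq.
split=> //; have := fineK gsfin.
move: (fine (gamma_int (1 + r))) => B gB.
have {}main x : 0 < x -> x <= 1 -> B <= (1 + r) * A + x * (5 * A).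
  move=> x0 x1; have x10 : 0 < 1 + x by rewrite ltr_wpDl.
  have := main x x0; rewrite -gB -EFinM -EFinD lee_fin => H.
  have am := weighted_amgm r01 x10 ltr01.
  rewrite powR1 mulr1 in am.
  have pw : (1 + x) `^ (1 + r) <= (1 + x) * (1 + r * x).
    rewrite powRD ?(gt_eqF x10) ?implybT// powRr1 ?(ltW x10)// ler_pM2l//.
    by apply: (le_trans am); lra.
  have H2 : A + (1 - (1 + x)^-1) * B <= (1 + x) * (1 + r * x) * A.
    rewrite mul1r in H; apply: (le_trans H); exact: ler_wpM2r.
  have E : (1 + x) * ((1 - (1 + x)^-1) * B) = x * B.
    by field; rewrite gt_eqF.
  have H3 : x * B <= x * ((1 + x) * (1 + r + r * x) * A).
    have := ler_wpM2l (ltW x10) H2; rewrite mulrDr E; lra.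
  rewrite ler_pM2l// in H3; apply: (le_trans H3).
  have -> : (1 + r) * A + x * (5 * A) = (1 + r + 5 * x) * A by ring.
  by apply: ler_wpM2r => //; nra.
apply/ler_addgt0Pr => e e0.
have A5 : 0 < 5 * A + 1 by rewrite ltr_wpDl// mulr_ge0.
pose x := Num.min 1 (e / (5 * A + 1)).
have x0 : 0 < x by rewrite lt_min ltr01 divr_gt0.
have x1 : x <= 1 by rewrite ge_min lexx.
have x2 : x <= e / (5 * A + 1) by rewrite ge_min lexx orbT.
apply: (le_trans (main x x0 x1)); rewrite lerD2l.
move: x2; rewrite ler_pdivlMr// => x2; nra.
Qed.

(** Integrate t (1 + r)^r <= (1 - r) t^(1 + r) + r (1 + r) t^r, an instance of
    weighted_amgm multiplied by t^r, against exp(-t): the left-hand side gives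
    (1 + r)^r and the right-hand side at most (1 + r) * Gamma (1 + r). *)
Lemma Gamma_ge (r : R) : 0 <= r <= 1 -> (1 + r) `^ (r - 1) <= Gamma (1 + r).
Proof.
move=> r01; have /andP[r0 r1] := r01.
have gfin := gamma_int_fin r01; have [gsfin succ_le] := gamma_int_succ_fin_le r01.
rewrite GammaE; have := fineK gfin; have := fineK gsfin.
move: (fine (gamma_int (1 + r))) (fine (gamma_int r)) succ_le => B A BA gB gA.
have c0 : 0 < 1 + r by rewrite ltr_wpDr.
have q0 : 0 <= 1 - r by rewrite subr_ge0.
have H : (((1 + r) `^ r)%:E * gamma_int 1 + 0%:E * gamma_int 1 <=
    (1 - r)%:E * gamma_int (1 + r) + (r * (1 + r))%:E * gamma_int r)%E.
  rewrite -!gamma_int_lin ?powR_ge0 ?mulr_ge0 ?(ltW c0)//.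
  have mI : measurable (`]0%R, +oo[%classic : set (measurableTypeR R)) by [].
  have mg s := measurable_gamma s mI.
  apply: ge0_le_integral => //.
  - by move=> t _; rewrite lee_fin addr_ge0 ?mulr_ge0 ?powR_ge0 ?expR_ge0.
  - apply/measurable_EFinP; apply: measurable_funD; apply: measurable_funM => //;
      apply/measurable_EFinP; exact: mg.
  - apply/measurable_EFinP; apply: measurable_funD; apply: measurable_funM => //;
      apply/measurable_EFinP; exact: mg.
  move=> t /=; rewrite in_itv/= andbT => t0; rewrite lee_fin mul0r addr0.
  have q01 : 0 <= 1 - r <= 1 by rewrite q0/= gerBl.
  have := weighted_amgm q01 t0 c0.
  rewrite (_ : 1 - (1 - r) = r); last by ring.
  move=> am.
  have tr : 0 <= t `^ r * expR (- t) by rewrite mulr_ge0 ?powR_ge0 ?expR_ge0.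
  have E1 : t `^ (1 + r) = t * t `^ r.
    by rewrite powRD ?(gt_eqF t0) ?implybT// powRr1// ltW.
  have E2 : t `^ 1 = t `^ r * t `^ (1 - r).
    by rewrite -powRD ?(gt_eqF t0) ?implybT// addrC subrK.
  rewrite E1 E2.
  have := ler_wpM2l tr am.
  move: (t `^ r) (t `^ (1 - r)) (expR (- t)) ((1 + r) `^ r) => a b c e; lra.
move: H; rewrite gamma_int1 mul0e adde0 mule1 -gA -gB.
rewrite -!EFinM -EFinD lee_fin => H.
have : (1 + r) * (1 + r) `^ (r - 1) <= (1 + r) * A.
  have -> : (1 + r) * (1 + r) `^ (r - 1) = (1 + r) `^ r.
    rewrite -{1}[1 + r](powRr1 (ltW c0)) -powRD ?(gt_eqF c0) ?implybT//.
    by congr (_ `^ _); ring.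
  by apply: (le_trans H); nra.
by rewrite ler_pM2l.
Qed.

(** By Gamma_ge the right-hand side is at least
    (1 + r)^(r - 1) * (2 - r)^(-r), and (1 - r) (1 + r) <= 1 and r (2 - r) <= 1. *)
Lemma Gamma_mul_ge (r : R) : 0 <= r <= 1 ->
  r `^ r * (1 - r) `^ (1 - r) <= Gamma (1 + r) * Gamma (2 - r).
Proof.
move=> r01; have /andP[r0 r1] := r01.
have q01 : 0 <= 1 - r <= 1 by rewrite subr_ge0 r1 gerBl.
have -> : 2 - r = 1 + (1 - r) by ring.
have G1 := Gamma_ge r01; have G2 := Gamma_ge q01.
rewrite [r `^ r * _]mulrC.
move: (Gamma _) (Gamma _) G1 G2 => G1 G2 le1 le2.
apply: ler_pM; [exact: powR_ge0|exact: powR_ge0| |].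
  apply: le_trans le1; rewrite -[r - 1]opprB powRN -powR_inv1 ?powR_ge0//.
  rewrite powRAC powR_inv1; last by lra.
  have [->|rn1] := eqVneq r 1; first by rewrite subrr !powRr0.
  apply: ge0_ler_powR; rewrite ?nnegrE ?subr_ge0//; first by rewrite invr_ge0; lra.
  by rewrite -div1r ler_pdivlMr; [nra|lra].
apply: le_trans le2; rewrite [1 - r - 1]addrAC subrr add0r powRN.
rewrite -powR_inv1 ?powR_ge0// powRAC powR_inv1; last by lra.
apply: ge0_ler_powR; rewrite ?nnegrE//; first by rewrite invr_ge0; lra.
by rewrite -div1r ler_pdivlMr; [nra|lra].
Qed.

End gamma_bounds.

(** * The constants *)

Section riesz_means.
Context {R : realType}.

(** From riesz_volume_Gamma, as (4 pi)^(d/2) * pi^(d/2) = (2 pi)^d. *)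
Lemma Lcl_riesz_volume d : Lcl 1 d = (2 * pi) ^- d * fine (@riesz_volume R d).
Proof.
have := @riesz_volume_Gamma R d; rewrite -/(gamma_int (1 + d%:R / 2)).
rewrite -(fineK (riesz_volume_fin_num (R := R) (d := d))).
have : (0 <= fine (@riesz_volume R d)).
  by apply: fine_ge0; apply: integral_ge0 => v _; rewrite lee_fin le_max lexx.
move: (fine (riesz_volume d)) => v v0.
have s0 : 0 < Num.sqrt pi :> R by rewrite sqrtr_gt0 pi_gt0.
have sd0 : 0 < Num.sqrt pi ^+ d :> R by rewrite exprn_gt0.
have := gamma_int_ge0 (1 + d%:R / 2 : R).
rewrite /Lcl -addrA !GammaE gamma_int1 /= mul1r.
case: (gamma_int (1 + d%:R / 2)) => [g|_|//]; last first.
  have [->|vn0] := eqVneq v 0.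
    by rewrite mul0e => -[] E; move: sd0; rewrite -E ltxx.
  by rewrite gt0_muley// lte_fin lt0r vn0.
rewrite lee_fin -EFinM => g0 [vg] /=.
have gp : 0 < g.
  by rewrite lt0r g0 andbT; apply: contraL sd0 => /eqP g00; rewrite -vg g00 mulr0 ltxx.
have -> : (4 * pi) `^ (d%:R / 2) = (2 * Num.sqrt pi) ^+ d :> R.
  rewrite [d%:R / 2]mulrC powRrM powR12_sqrt ?mulr_ge0 ?pi_ge0// powR_mulrn ?sqrtr_ge0//.
  rewrite sqrtrM// (_ : 4 = 2 ^+ 2); last by rewrite expr2; ring.
  by rewrite sqrtr_sqr ger0_norm.
have -> : 2 * pi = (2 * Num.sqrt pi) * Num.sqrt pi :> R.
  by rewrite -mulrA -expr2 sqr_sqrtr// pi_ge0.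
rewrite !exprMn -vg; have : 2 ^+ d != 0 :> R by rewrite expf_neq0.
have vp : v != 0 by apply: contraL sd0 => /eqP v00; rewrite -vg v00 mul0r ltxx.
move: (2 ^+ d) => t t0; field; rewrite t0 vp gt_eqF//.
Qed.

Lemma powRVl (x r : R) : 0 <= x -> x^-1 `^ r = (x `^ r)^-1.
Proof. by move=> x0; rewrite -powR_inv1// -powRrM mulN1r powRN. Qed.

Lemma inf_attained (A : set R) (x : R) : A x -> lbound A x -> inf A = x.
Proof.
move=> Ax lbx; apply/eqP; rewrite eq_le; apply/andP; split.
  by apply: ge_inf => //; exists x.
by apply: lb_le_inf => //; exists x.
Qed.

Section kconst.
Variables (d : nat) (rho : R).
Hypotheses (d_gt0 : (0 < d)%N) (rho_ge0 : 0 <= rho) (rho_lt1 : rho < 1).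

Definition Kvalue : R := 1 / (1 - rho) `^ (1 - rho) *
    ((1 + d%:R / 2) `^ (1 + d%:R / 2) / (rho + d%:R / 2) `^ (rho + d%:R / 2)).

Let b0 : 0 < 1 - rho. Proof. by rewrite subr_gt0. Qed.
Let c0 : 0 < rho + d%:R / 2.
Proof. by rewrite ltr_wpDl// divr_gt0// ltr0n. Qed.

(** The minimum is at t = (1 - rho) / (rho + d/2). *)
Lemma Kvalue_attained : exists2 t : R, 0 < t &
  (1 + t) `^ (1 + d%:R / 2) / t `^ (1 - rho) = Kvalue.
Proof.
exists ((1 - rho) / (rho + d%:R / 2)); first by rewrite divr_gt0.
rewrite /Kvalue.
have aE : 1 + d%:R / 2 = (1 - rho) + (rho + d%:R / 2) by ring.
rewrite aE; move: (1 - rho) (rho + d%:R / 2) b0 c0 => b c b1 c1.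
have bc : 0 < b + c by rewrite addr_gt0.
have -> : 1 + b / c = (b + c) / c by field; rewrite gt_eqF.
rewrite !powRM ?invr_ge0 ?(ltW bc) ?(ltW b1) ?(ltW c1)//.
rewrite !powRVl ?(ltW c1)//.
rewrite [c `^ (b + c)]powRD; last by rewrite (gt_eqF c1) implybT.
have := powR_gt0 b c1; have := powR_gt0 c c1; have := powR_gt0 b b1.
move: (c `^ b) (c `^ c) (b `^ b) ((b + c) `^ _) => x y t w t0 y0 x0.
by field; rewrite !gt_eqF.
Qed.

(** With b = 1 - rho and c = rho + d/2, so that b + c = 1 + d/2, this is
    scaled_amgm for p = b / (b + c), x = t, y = 1, raised to the power b + c. *)
Lemma Kvalue_le (t : R) : 0 < t ->
  Kvalue <= (1 + t) `^ (1 + d%:R / 2) / t `^ (1 - rho).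
Proof.
move=> t0; rewrite /Kvalue.
have aE : 1 + d%:R / 2 = (1 - rho) + (rho + d%:R / 2) by ring.
rewrite aE; move: (1 - rho) (rho + d%:R / 2) b0 c0 => b c b1 c1.
have bc : 0 < b + c by rewrite addr_gt0.
have p1 : 1 - b / (b + c) = c / (b + c) by field; rewrite gt_eqF.
have p01 : 0 <= b / (b + c) < 1.
  by rewrite divr_ge0 ?(ltW b1) ?(ltW bc)//= ltr_pdivrMr// mul1r ltrDl.
have := scaled_amgm p01 t0 ltr01; rewrite powR1 mulr1 p1 [t + 1]addrC => H.
have {}H := ge0_ler_powR (ltW bc) _ _ H.
have t1 : 0 < 1 + t by rewrite ltr_wpDl.
move: H; rewrite !nnegrE powR_ge0 !mulr_ge0 ?powR_ge0 ?(ltW t1)// => /(_ isT isT).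
rewrite !powRM ?mulr_ge0 ?invr_ge0 ?powR_ge0 ?(ltW t1) ?(ltW bc) ?(ltW b1) ?(ltW c1)//.
rewrite -!powRrM.
have E1 : b / (b + c) * (b + c) = b by rewrite divfK// gt_eqF.
have E2 : c / (b + c) * (b + c) = c by rewrite divfK// gt_eqF.
rewrite E1 E2 !powRVl ?(ltW bc)// => H.
rewrite [in leLHS]powRD; last by rewrite (gt_eqF bc) implybT.
have := powR_gt0 b bc; have := powR_gt0 c bc; have := powR_gt0 b b1.
have := powR_gt0 c c1; have := powR_gt0 b t0; move: H.
move: (t `^ b) (b `^ b) (c `^ c) ((b + c) `^ b) ((b + c) `^ c) ((1 + t) `^ _).
move=> T bb cc x y w H T0 cc0 bb0 y0 x0.
rewrite ler_pdivlMr// (_ : _ * T = (T * (x * y)) / (bb * cc)); last first.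
  by field; rewrite !gt_eqF.
rewrite ler_pdivrMr ?mulr_gt0// -ler_pdivlMr ?mulr_gt0//.
apply: (le_trans H); rewrite le_eqVlt; apply/orP; left; apply/eqP.
by field; rewrite !gt_eqF.
Qed.

Lemma KconstE : Kconst rho d = Kvalue.
Proof.
rewrite /Kconst; apply: inf_attained.
  by have [t t0 tE] := Kvalue_attained; exists t.
by move=> _ [t /= t0 <-]; exact: Kvalue_le.
Qed.

End kconst.

End riesz_means.

(** * Riesz means *)

Section riesz_bounds.
Context {R : realType} {d : nat}.
Variables (Omega : set 'rV[R]_d) (lambda : nat -> R).
Hypotheses (Omega_open : open Omega) (Omega_bounded : bounded_set Omega).
Hypothesis lambdaP : dirichlet_eigenvalues Omega lambda.

Definition berezin_bound (z : R) : R :=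
  Lcl 1 d * fine (lebesgue_rV Omega) * (z * z `^ (d%:R / 2)).

(** The eigenvalues are nondecreasing, so the terms with a positive part form an
    initial segment, where eigen_berezin applies. *)
Lemma berezin_li_yau (z : R) n : 0 < z ->
  \sum_(k < n) Num.max 0 (z - lambda k) <= berezin_bound z.
Proof.
move=> z0; have bound m : \sum_(k < m) (z - lambda k) <= berezin_bound z.
  have := eigen_berezin Omega_open Omega_bounded lambdaP m z0.
  rewrite /berezin_bound Lcl_riesz_volume => H; apply: (le_trans H).
  move: ((2 * pi) ^- d) (fine (riesz_volume d)) (fine _) (z `^ _) => a b c e.
  by rewrite le_eqVlt; apply/orP; left; apply/eqP; ring.
have [ndl _] := lambdaP.
elim: n => [|n IHn]; first by have := bound 0%N; rewrite !big_ord0.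
have [zl|zl] := leP (z - lambda n) 0.
  by rewrite big_ord_recr/= max_l// addr0.
apply: le_trans (bound n.+1); apply: ler_sum => k _.
rewrite max_r//; apply: (le_trans (ltW zl)); rewrite lerD2l lerN2.
by apply: ndl; rewrite -ltnS.
Qed.

Lemma series_le_berezin (z c : R) (u : nat -> R) : 0 < z -> 0 <= c ->
  (forall k, 0 <= u k) -> (forall k, u k <= c * Num.max 0 (z - lambda k)) ->
  (\sum_(0 <= k <oo) (u k)%:E <= (c * berezin_bound z)%:E)%E.
Proof.
move=> z0 c0 u0 uz; apply: lime_le.
  by apply: is_cvg_nneseries => k _ _; rewrite lee_fin.
near=> n; rewrite sumEFin lee_fin big_mkord.
apply: (@le_trans _ _ (\sum_(k < n) c * Num.max 0 (z - lambda k))).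
  by apply: ler_sum => k _.
by rewrite -mulr_sumr; apply: ler_wpM2l => //; exact: berezin_li_yau.
Unshelve. all: end_near. Qed.

Variable (rho : R).
Hypotheses (rho_ge0 : 0 <= rho) (rho_lt1 : rho < 1).

(** The term of the Riesz mean, in a form that covers rho = 0, where the power
    0^0 = 1 would also count the eigenvalues above z. *)
Definition riesz_term (z : R) (k : nat) : R :=
  if rho == 0 then (lambda k <= z)%R%:R else Num.max 0 (z - lambda k) `^ rho.

Lemma riesz_meanE z :
  riesz_mean lambda rho z = (\sum_(0 <= k <oo) (riesz_term z k)%:E)%E.
Proof.
rewrite /riesz_mean /riesz_term; case: ifPn => // _.
rewrite counting_dirac; apply: eq_eseriesr => k _.
rewrite diracE; congr ((nat_of_bool _)%:R%:E).
by apply/idP/idP; rewrite inE.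
Qed.

Lemma riesz_term_ge0 z k : 0 <= riesz_term z k.
Proof. by rewrite /riesz_term; case: ifP => _; rewrite ?powR_ge0. Qed.

Lemma riesz_term_le z z' k : z <= z' -> riesz_term z k <= riesz_term z' k.
Proof.
move=> zz'; rewrite /riesz_term; case: ifP => _.
  by rewrite ler_nat; case: leP => // lz; rewrite (le_trans lz zz').
apply: ge0_ler_powR => //.
- by rewrite nnegrE le_max lexx.
- by rewrite nnegrE le_max lexx.
by rewrite ge_max !le_max lexx/= lerD2r zz' orbT.
Qed.

Lemma riesz_term_le_linear (z a : R) k : 0 < a ->
  riesz_term z k <=
  rho `^ rho * (1 - rho) `^ (1 - rho) * a `^ (rho - 1) *
    Num.max 0 (z + a - lambda k).
Proof.
move=> a0; rewrite /riesz_term.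
have rhs0 x : 0 <= rho `^ rho * (1 - rho) `^ (1 - rho) * a `^ (rho - 1) *
    Num.max 0 x by rewrite !mulr_ge0 ?powR_ge0// le_max lexx.
have [r0|rn0] := eqVneq rho 0.
  case: (leP (lambda k) z) => lz; last exact: rhs0.
  rewrite r0 powRr0 !subr0 powR1 !mul1r sub0r powR_inv1 ?(ltW a0)//.
  rewrite mulrC ler_pdivlMr// mul1r le_max; apply/orP; right; lra.
have [zl|zl] := leP (z - lambda k) 0.
  by rewrite powR0.
have := scaled_amgm (p := rho) (x := z - lambda k) (y := a).
rewrite rho_ge0 rho_lt1 => /(_ isT zl a0) H.
have ap : 0 < a `^ (1 - rho) by exact: powR_gt0.
rewrite max_r; last by lra.
rewrite -[rho - 1]opprB powRN -(ler_pM2r ap); apply: (le_trans H).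
rewrite le_eqVlt; apply/orP; left; apply/eqP.
move: (rho `^ rho) ((1 - rho) `^ _) (a `^ _) ap => x y w w0.
by field; rewrite gt_eqF.
Qed.

Definition riesz_constant : R :=
  Kconst rho d * Gamma (1 + rho) * Gamma (2 - rho) * Lcl 1 d *
  fine (lebesgue_rV Omega).

Lemma riesz_mean_le_pos (z : R) : (0 < d)%N -> 0 < z ->
  (riesz_mean lambda rho z <= (riesz_constant * z `^ (rho + d%:R / 2))%:E)%E.
Proof.
move=> d0 z0; rewrite riesz_meanE.
have [t t0 tK] := Kvalue_attained d0 rho_ge0 rho_lt1.
rewrite -(KconstE d0 rho_ge0 rho_lt1) in tK.
have a0 : 0 < t * z by rewrite mulr_gt0.
set c := rho `^ rho * (1 - rho) `^ (1 - rho).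
have c0 : 0 <= c by rewrite mulr_ge0 ?powR_ge0.
have zt0 : 0 < z + t * z by rewrite addr_gt0.
have t1 : 0 < 1 + t by rewrite ltr_wpDl.
have Lc0 : 0 <= Lcl 1 d :> R.
  rewrite Lcl_riesz_volume mulr_ge0 ?invr_ge0 ?exprn_ge0 ?mulr_ge0 ?pi_ge0//.
  by apply: fine_ge0; apply: integral_ge0 => v _; rewrite lee_fin le_max lexx.
have vol0 : 0 <= fine (lebesgue_rV Omega) by exact: fine_ge0.
apply: (@le_trans _ _ (c * (t * z) `^ (rho - 1) * berezin_bound (z + t * z))%:E).
  apply: series_le_berezin => //; first by rewrite mulr_ge0 ?powR_ge0.
    by move=> k; exact: riesz_term_ge0.
  by move=> k; exact: riesz_term_le_linear.
rewrite lee_fin /berezin_bound /riesz_constant -tK.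
have -> : z + t * z = (1 + t) * z by ring.
rewrite !(powRM _ (ltW t0) (ltW z0)) !(powRM _ (ltW t1) (ltW z0)).
have -> : (1 + t) `^ (1 + d%:R / 2) = (1 + t) * (1 + t) `^ (d%:R / 2).
  by rewrite powRD ?(gt_eqF t1) ?implybT// powRr1// ltW.
have -> : z `^ (rho + d%:R / 2) = z `^ (rho - 1) * z * z `^ (d%:R / 2).
  transitivity (z `^ (rho - 1) * z `^ 1 * z `^ (d%:R / 2)).
    rewrite -!powRD ?(gt_eqF z0) ?implybT//; congr (_ `^ _); ring.
  by rewrite powRr1// ltW.
rewrite -[t `^ (rho - 1)]invrK -powRN opprB.
have G := Gamma_mul_ge (r := rho).
rewrite rho_ge0 (ltW rho_lt1) in G; have {}G := G isT.
have w1 : 0 <= (1 + t) `^ (d%:R / 2) by exact: powR_ge0.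
have w2 : 0 <= t `^ (1 - rho) by exact: powR_ge0.
have w3 : 0 <= z `^ (rho - 1) by exact: powR_ge0.
have w4 : 0 <= z `^ (d%:R / 2) by exact: powR_ge0.
rewrite -/c in G; move: G c0 Lc0 vol0 w1 w2 w3 w4.
move: (Gamma _) (Gamma _) (Lcl 1 d) (fine _) => G1 G2 L V.
move: ((1 + t) `^ _) (t `^ _) (z `^ (rho - 1)) (z `^ (d%:R / 2)) c.
move=> x1 x2 x3 x4 c G c0 L0 V0 x10 x20 x30 x40.
have X0 : 0 <= x2^-1 * ((1 + t) * x1) * L * V * (x3 * z * x4).
  by rewrite !mulr_ge0 ?invr_ge0 ?(ltW t1) ?(ltW z0).
rewrite [leLHS](_ : _ = c * (x2^-1 * ((1 + t) * x1) * L * V * (x3 * z * x4))); last by ring.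
rewrite [leRHS](_ : _ = (G2 * G1) * (x2^-1 * ((1 + t) * x1) * L * V * (x3 * z * x4))).
  exact: (ler_wpM2r X0 G).
by ring.
Qed.

(** At z = 0 the bound is 0; it is the limit of the bounds at small z > 0, since
    Riesz means are nondecreasing in z. *)
Lemma riesz_mean_le (z : R) : (0 < d)%N -> 0 <= z ->
  (riesz_mean lambda rho z <= (riesz_constant * z `^ (rho + d%:R / 2))%:E)%E.
Proof.
move=> d0; rewrite le_eqVlt => /predU1P[<-|]; last exact: riesz_mean_le_pos.
have p0 : 0 < rho + d%:R / 2 by rewrite ltr_wpDl// divr_gt0// ltr0n.
rewrite powR0 ?gt_eqF// mulr0; apply/lee_addgt0Pr => e e0; rewrite add0e.
set D := `|riesz_constant| + 1.
have D0 : 0 < D by rewrite ltr_wpDl.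
(* The point where the bound, with D instead of the constant, equals e. *)
pose y := (e / D) `^ (rho + d%:R / 2)^-1.
have y0 : 0 < y by rewrite powR_gt0// divr_gt0.
have yp : y `^ (rho + d%:R / 2) = e / D.
  by rewrite -powRrM mulVf ?gt_eqF// powRr1// ltW// divr_gt0.
apply: (@le_trans _ _ (riesz_mean lambda rho y)).
  rewrite !riesz_meanE; apply: lee_nneseries => k _.
    by move=> _; rewrite lee_fin riesz_term_ge0.
  by rewrite lee_fin riesz_term_le// ltW.
apply: (le_trans (riesz_mean_le_pos d0 y0)); rewrite yp lee_fin.
rewrite mulrA ler_pdivrMr// mulrC ler_pM2l// /D.
by apply: (le_trans (ler_norm _)); rewrite lerDl.
Qed.

End riesz_bounds.

Theorem theorem1p2 (R : realType) (d : nat) (Omega : set 'rV[R]_d)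
    (rho : R) (lambda : nat -> R)
    (d_gt0 : (0 < d)%N)
    (Omega_neq0 : Omega !=set0)
    (Omega_open : open Omega)
    (Omega_connected : connected Omega)
    (Omega_bounded : bounded_set Omega)
    (rho_ge0 : 0 <= rho) (rho_lt1 : rho < 1)
    (lambdaP : dirichlet_eigenvalues Omega lambda) :
  (forall z : R, 0 <= z ->
    (riesz_mean lambda rho z <=
     (Kconst rho d * Gamma (1 + rho) * Gamma (2 - rho) * Lcl 1 d)%:E *
     lebesgue_rV Omega * (z `^ (rho + d%:R / 2))%:E)%E) /\
  Kconst rho d =
    1 / (1 - rho) `^ (1 - rho) *
    ((1 + d%:R / 2) `^ (1 + d%:R / 2) / (rho + d%:R / 2) `^ (rho + d%:R / 2)).
Proof.
split=> [z z0|]; last exact: KconstE.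
have Ofin : lebesgue_rV Omega \is a fin_num.
  by rewrite ge0_fin_numE// (bounded_measure_fin Omega_open Omega_bounded).
rewrite -(fineK Ofin) -!EFinM.
exact: (riesz_mean_le Omega_open Omega_bounded lambdaP rho_ge0 rho_lt1).
Qed.
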